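(* Let $\alpha,\alpha_1,\ldots,\alpha_N$ be non-zero algebraic numbers with $\alpha=\alpha_1\cdots\alpha_N$. Then there exist a root of unity $\zeta$ and algebraic numbers $\beta_1,\ldots,\beta_N$ such that (i) $\alpha=\zeta\beta_1\cdots\beta_N$; (ii) $\beta_n\in\mathrm{rad}(K_\alpha)$ for all $n$; (iii) $M(\beta_n)\le M(\alpha_n)$ for all $n$.
   Context: Let $\overline{\mathbb{Q}}$ be an algebraic closure of $\mathbb{Q}$. For a number field $K$ and a place $v$ of $K$ over the place $p$ of $\mathbb{Q}$, let $\|\cdot\|_v$ extend the usual absolute value of $\mathbb{Q}_p$ to $K_v$ and set $|x|_v=\|x\|_v^{[K_v:\mathbb{Q}_p]/[K:\mathbb{Q}]}$. The Weil height is $H(x)=\prod_v\max\{1,|x|_v\}$ over all places of $K$ (independent of $K$), and the Mahler measure is $M(x)=H(x)^{[\mathbb{Q}(x):\mathbb{Q}]}$. $K_\alpha$ denotes the Galois closure of $\mathbb{Q}(\alpha)$ over $\mathbb{Q}$. For a number field $K$, $\mathrm{rad}(K)=\{x\in\overline{\mathbb{Q}}^\times: x^r\in K \text{ for some } r\in\mathbb{N}\}$. *)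

(* Defs.v *)
From HB Require Import structures.
From mathcomp Require Import all_boot all_order all_algebra all_field.
From mathcomp Require Import ring_quotient generic_quotient.
From mathcomp Require Import all_classical all_reals.
From mathcomp Require Import exp.
From mathcomp Require Import ring lra.

Set Implicit Arguments.
Unset Strict Implicit.
Unset Printing Implicit Defensive.

Import Order.TTheory GRing.Theory Num.Theory.
Local Open Scope classical_set_scope.
Local Open Scope ring_scope.
Local Open Scope quotient_scope.

Record absval (R : realType) (F : fieldType) := AbsVal {
  absv :> F -> R;
  absv_ge0 : forall x, 0 <= absv x;
  absv_eq0 : forall x, (absv x == 0) = (x == 0);
  absvM : forall x y, absv (x * y) = absv x * absv y;
  absv_triangle : forall x y, absv (x + y) <= absv x + absv y
}.

HB.instance Definition _ (R : realType) (F : fieldType) :=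
  gen_eqMixin (absval R F).
HB.instance Definition _ (R : realType) (F : fieldType) :=
  gen_choiceMixin (absval R F).

Section Completion.
Variables (R : realType) (F : fieldType) (v : absval R F).
Implicit Types (x y : F) (u w : nat -> F).

Lemma absv0 : v 0 = 0. Proof. by apply/eqP; rewrite absv_eq0. Qed.

Lemma absv1 : v 1 = 1.
Proof.
have n0 : v 1 != 0 by rewrite absv_eq0 oner_eq0.
by apply: (mulfI n0); rewrite -absvM !mulr1.
Qed.

Lemma absvN x : v (- x) = v x.
Proof.
have h : v (-1) = 1.
  have := absvM v (-1) (-1); rewrite mulrNN mulr1 absv1 => /esym/eqP.
  rewrite -expr2 sqrf_eq1 => /orP[/eqP //|/eqP h].
  by have := absv_ge0 v (-1); rewrite h; lra.
by rewrite -mulN1r absvM h mul1r.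
Qed.

Lemma absvB x y : v (x - y) <= v x + v y.
Proof. by rewrite -(absvN y); apply: absv_triangle. Qed.

Lemma absv_rev x y : v x - v y <= v (x - y).
Proof. by have := absv_triangle v (x - y) y; rewrite subrK; lra. Qed.

Lemma absvV x : x != 0 -> v x^-1 = (v x)^-1.
Proof.
move=> x0; have vx : v x != 0 by rewrite absv_eq0.
by apply: (mulfI vx); rewrite -absvM !divff // absv1.
Qed.

Definition cauchy_seq u := forall e : R, 0 < e ->
  exists n0, forall m n, (n0 <= m)%N -> (n0 <= n)%N -> v (u m - u n) < e.

Definition null_seq u := forall e : R, 0 < e ->
  exists n0, forall n, (n0 <= n)%N -> v (u n) < e.

Lemma cauchy_bounded u : cauchy_seq u ->
  exists2 B : R, 0 < B & forall n, v (u n) <= B.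
Proof.
move=> /(_ 1 ltr01)[n0 hn0].
pose B := \sum_(i < n0.+1) v (u i) + 1.
have S0 k : 0 <= \sum_(i < k) v (u i) by apply: sumr_ge0 => i _; apply: absv_ge0.
have le_sum n : (n <= n0)%N -> v (u n) <= \sum_(i < n0.+1) v (u i).
  move=> le; rewrite (bigD1 (Ordinal (le : (n < n0.+1)%N))) //= lerDl.
  by apply: sumr_ge0 => i _; apply: absv_ge0.
exists B; first by rewrite /B; have := S0 n0.+1; lra.
move=> n; have [le|lt] := leqP n n0; first by have := le_sum _ le; rewrite /B; lra.
have := hn0 n n0 (ltnW lt) (leqnn _); have := absv_rev (u n) (u n0).
by have := le_sum _ (leqnn n0); rewrite /B; lra.
Qed.

Definition cauchy_pred : {pred nat -> F} := fun u => `[< cauchy_seq u >].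

Lemma cauchy_subring : subring_closed cauchy_pred.
Proof.
split.
- by apply/asboolP => e e0; exists 0%N => m n _ _; rewrite subrr absv0.
- move=> u w /asboolP hu /asboolP hw; apply/asboolP => e e0.
  have e2 : 0 < e / 2 by lra.
  have [n1 h1] := hu _ e2; have [n2 h2] := hw _ e2.
  exists (maxn n1 n2) => m n; rewrite !geq_max => /andP[m1 m2] /andP[k1 k2].
  have -> : (u - w) m - (u - w) n = (u m - u n) - (w m - w n).
    by rewrite /= !fctE; ring.
  have := absvB (u m - u n) (w m - w n); have := h1 _ _ m1 k1; have := h2 _ _ m2 k2.
  lra.
- move=> u w /asboolP hu /asboolP hw; apply/asboolP => e e0.
  have [B B0 hB] := cauchy_bounded hu; have [C C0 hC] := cauchy_bounded hw.
  have eC : 0 < e / 2 / C by rewrite !divr_gt0.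
  have eB : 0 < e / 2 / B by rewrite !divr_gt0.
  have [n1 h1] := hu _ eC; have [n2 h2] := hw _ eB.
  exists (maxn n1 n2) => m n; rewrite !geq_max => /andP[m1 m2] /andP[k1 k2].
  have -> : (u * w) m - (u * w) n = (u m - u n) * w m + u n * (w m - w n).
    by rewrite /= !fctE; ring.
  apply: le_lt_trans (absv_triangle _ _ _) _; rewrite !absvM.
  have -> : e = e / 2 / C * C + B * (e / 2 / B).
    by rewrite divfK ?gt_eqF// [B * _]mulrC divfK ?gt_eqF//; lra.
  apply: ltr_leD.
    apply: le_lt_trans (_ : v (u m - u n) * C < _).
      by rewrite ler_wpM2l ?absv_ge0.
    by rewrite ltr_pM2r //; apply: h1.
  by apply: ler_pM; rewrite ?absv_ge0 // ltW // h2.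
Qed.

HB.instance Definition _ :=
  GRing.isSubringClosed.Build (nat -> F) cauchy_pred cauchy_subring.

Record cauchy_ring := CauchySeq { cauchy_val :> nat -> F; _ : cauchy_val \in cauchy_pred }.

HB.instance Definition _ := [isSub for cauchy_val].
HB.instance Definition _ := [Choice of cauchy_ring by <:].
HB.instance Definition _ := [SubChoice_isSubComNzRing of cauchy_ring by <:].

Lemma cauchy_ringP (u : cauchy_ring) : cauchy_seq u.
Proof. by case: u => u /= /asboolP. Qed.

Definition null_pred : {pred cauchy_ring} := fun u : cauchy_ring => `[< null_seq u >].

Lemma null_idealr : idealr_closed null_pred.
Proof.
split.
- by apply/asboolP => e e0; exists 0%N => n _; rewrite absv0.
- apply/negP => /asboolP /(_ 1 ltr01)[n0 /(_ n0 (leqnn _))].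
  by rewrite absv1 ltxx.
- move=> a u w /asboolP hu /asboolP hw; apply/asboolP => e e0.
  have [B B0 hB] := cauchy_bounded (@cauchy_ringP a).
  have e2 : 0 < e / 2 by lra.
  have eB : 0 < e / 2 / B by rewrite !divr_gt0.
  have [n1 h1] := hu _ eB; have [n2 h2] := hw _ e2.
  exists (maxn n1 n2) => n; rewrite geq_max => /andP[k1 k2].
  apply: le_lt_trans (absv_triangle _ _ _) _.
  have -> : e = B * (e / 2 / B) + e / 2.
    by rewrite [B * _]mulrC divfK ?gt_eqF//; lra.
  apply: ler_ltD; last exact: h2.
  by rewrite absvM; apply: ler_pM; rewrite ?absv_ge0 // ltW // h1.
Qed.

HB.instance Definition _ := isIdealr.Build cauchy_ring null_pred null_idealr.

Definition completion := {ideal_quot null_pred}.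

HB.instance Definition _ := GRing.ComNzRing.on completion.
HB.instance Definition _ := EqQuotient.on completion.

Lemma nonnull_away u : cauchy_seq u -> ~ null_seq u ->
  exists2 c : R, 0 < c & exists n0, forall n, (n0 <= n)%N -> c <= v (u n).
Proof.
move=> hu /existsNP[e /not_implyP[e0 /forallNP he]].
have e2 : 0 < e / 2 by lra.
have [n0 h0] := hu _ e2; exists (e / 2) => //; exists n0 => n le.
have /existsNP[m /not_implyP[lm /negP]] := he n0; rewrite -leNgt => hm.
have := h0 _ _ lm le; have := absv_rev (u m) (u n); lra.
Qed.

Lemma cauchy_inv u : cauchy_seq u -> ~ null_seq u ->
  cauchy_seq (fun n => (u n)^-1).
Proof.
move=> hu nu; have [c c0 [n1 h1]] := nonnull_away hu nu.
move=> e e0; have ec : 0 < e * (c * c) by rewrite !mulr_gt0.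
have [n2 h2] := hu _ ec; exists (maxn n1 n2) => m n.
rewrite !geq_max => /andP[m1 m2] /andP[k1 k2].
have vm := h1 _ m1; have vn := h1 _ k1.
have vm0 : 0 < v (u m) by lra.
have vn0 : 0 < v (u n) by lra.
have um0 : u m != 0 by rewrite -(absv_eq0 v) gt_eqF.
have un0 : u n != 0 by rewrite -(absv_eq0 v) gt_eqF.
have -> : (u m)^-1 - (u n)^-1 = (u n - u m) / (u m * u n).
  by field; rewrite um0 un0.
rewrite absvM absvV ?mulf_neq0// absvM ltr_pdivrMr ?mulr_gt0//.
apply: lt_le_trans (h2 _ _ k2 m2) _.
by rewrite ler_pM2l//; apply: ler_pM => //; apply: ltW.
Qed.

Lemma completion_inv_ex (x : completion) :
  exists y : completion, if x == 0 then y == 0 else y * x == 1.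
Proof.
have [x0|x0] := eqVneq x 0; first by exists 0.
have nu : ~ null_seq (repr x).
  move=> nx; move/eqP: x0; apply; rewrite -[x]reprK.
  have -> : 0 = \pi_completion (0 : cauchy_ring) by rewrite raddf0.
  by apply/eqP; rewrite -Quotient.idealrBE subr0; apply/asboolP.
have cu := cauchy_inv (@cauchy_ringP (repr x)) nu.
pose w : cauchy_ring := CauchySeq (introT (asboolP _) cu).
exists (\pi w); rewrite -{1}[x]reprK -rmorphM -(rmorph1 (\pi_completion)).
rewrite -Quotient.idealrBE; apply/asboolP => e e0.
have [c c0 [n1 h1]] := nonnull_away (@cauchy_ringP (repr x)) nu.
exists n1 => n /h1 hn; rewrite /= !fctE /=.
have un0 : (repr x : nat -> F) n != 0 by rewrite -(absv_eq0 v) gt_eqF //; lra.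
by rewrite mulVf // subrr absv0.
Qed.

Definition completion_inv (x : completion) := xchoose (completion_inv_ex x).

Lemma completion_mulVf (x : completion) : x != 0 -> completion_inv x * x = 1.
Proof.
move=> x0; have := xchooseP (completion_inv_ex x); rewrite -/(completion_inv x).
by rewrite (negPf x0) => /eqP.
Qed.

Lemma completion_inv0 : completion_inv 0 = 0.
Proof.
have := xchooseP (completion_inv_ex 0); rewrite -/(completion_inv 0).
by rewrite eqxx => /eqP.
Qed.

HB.instance Definition _ := GRing.ComNzRing_isField.Build completion
  completion_mulVf completion_inv0.

End Completion.

Section NumberFieldPlaces.
Variables (R : realType) (K : fieldExtType rat).

(* [None] is the archimedean place of the rationals, [Some p] the p-adic one. *)
Definition rat_abs (p : option nat) (q : rat) : R :=
  if p is Some p then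
    if q == 0 then 0
    else p%:R ^+ logn p `|denq q| / p%:R ^+ logn p `|numq q|
  else `|ratr q|.

Definition is_rat_place (p : option nat) : bool :=
  if p is Some p then prime p else true.

(* A place of K is represented by the unique absolute value in its class that
   restricts to the usual p-adic or archimedean absolute value of the
   rationals. *)
Definition number_field_places : set (absval R K) :=
  [set v | exists2 p, is_rat_place p & forall q : rat, v q%:A = rat_abs p q].

(* The copy of Q_p inside K_v: the closure of the rationals, i.e. the limits of
   Cauchy sequences of rationals. *)
Definition Qp_in (v : absval R K) : set (completion v) :=
  [set x | exists2 u : cauchy_ring v,
    forall n, exists q : rat, u n = q%:A & x = \pi_(completion v) u].

Definition has_local_degree (v : absval R K) (d : nat) : Prop :=
  exists e : 'I_d -> completion v, forall x : completion v,
    exists! c : 'I_d -> completion v,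
      (forall i, Qp_in (c i)) /\ x = \sum_(i < d) c i * e i.

(* [K_v : Q_p] *)
Definition local_degree (v : absval R K) : nat := xget 0%N (has_local_degree v).

Definition normalized_abs (v : absval R K) (x : K) : R :=
  v x `^ ((local_degree v)%:R / (\dim {:K})%:R).

(* A finitely supported product: almost all factors are 1. *)
Definition weil_height_in (x : K) : R :=
  \big[*%R/1]_(v \in number_field_places) Num.max 1 (normalized_abs v x).

End NumberFieldPlaces.

Section AlgebraicNumbers.
Implicit Types a x : algC.

Definition Qadj a : fieldExtType rat := tag (num_field_exists [:: a]).

Definition Qadj_embed a : {rmorphism Qadj a -> algC} :=
  tag (tagged (num_field_exists [:: a])).

Definition Qadj_gen a : Qadj a :=
  head 0 (s2val (tagged (tagged (num_field_exists [:: a])))).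

Lemma Qadj_genE a : Qadj_embed a (Qadj_gen a) = a.
Proof.
have := s2valP (tagged (tagged (num_field_exists [:: a]))).
by rewrite /Qadj_gen; case: (s2val _) => [|y [|z s]] //= [].
Qed.

Lemma Qadj_full a : <<1; Qadj_gen a>>%VS = fullv.
Proof.
have := s2valP (tagged (tagged (num_field_exists [:: a]))).
have := s2valP' (tagged (tagged (num_field_exists [:: a]))).
rewrite /Qadj_gen; case: (s2val _) => [|y [|z s]] //= h _.
by rewrite -h adjoin_seq1.
Qed.

(* The height does not depend on the number field containing a; it is computed
   in the rational field extension generated by a. *)
Definition weil_height (R : realType) a : R := weil_height_in R (Qadj_gen a).

Definition mahler_measure (R : realType) a : R :=
  weil_height R a ^+ \dim {:Qadj a}.

Definition normal_over_rat (F : {pred algC}) : Prop :=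
  forall x, x \in F -> forall y, root (minCpoly x) y -> y \in F.

(* Smallest subfield of algC that is normal (hence, in characteristic 0,
   Galois) over the rationals and contains a. *)
Definition galois_closure a : set algC :=
  [set x | forall F : {pred algC},
     divring_closed F -> normal_over_rat F -> a \in F -> x \in F].

Definition radical_set (K : set algC) : set algC :=
  [set x | x != 0 /\ exists2 r : nat, (0 < r)%N & K (x ^+ r)].

Definition is_root_of_unity x : Prop := exists2 m : nat, (0 < m)%N & x ^+ m = 1.

End AlgebraicNumbers.

(* Main.v *)
From HB Require Import structures.
Require Import Defs.
From mathcomp Require Import all_boot all_order all_algebra all_fingroup all_field.
From mathcomp Require Import ring_quotient generic_quotient.
From mathcomp Require Import all_classical all_reals.
From mathcomp Require Import exp.
From mathcomp Require Import zify ring lra.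
Import Order.TTheory GRing.Theory Num.Theory.
Set Implicit Arguments.
Unset Strict Implicit.
Unset Printing Implicit Defensive.
Local Open Scope classical_set_scope.
Local Open Scope ring_scope.

(* Fix for every place p of the rationals one extension w_p of the p-adic absolute value to algC.
   The places of K = Q(a) above p are the pull-backs of w_p along the embeddings of K, and the
   local degree of a place v is the number of embeddings inducing v. Hence M(a) is the product
   over p, and over the conjugates y of a, of max(1, w_p(y)).
   Let L be a Galois extension of Q containing the conjugates of all the given numbers, and let
   c_n be the product of the orbit of alpha_n under the normal subgroup H = Gal(L / K_alpha).
   If the orbit has m_n elements, beta_n is an m_n-th root of c_n. The product formula gives
   M(beta_n) <= M(c_n), as a conjugate of c_n has at most m_n roots of order m_n, and
   M(c_n) <= M(alpha_n), as the conjugates of alpha_n split into H-orbits of size m_n, permuted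
   by Gal(L / Q), whose products are the conjugates of c_n. Finally the product of the conjugates
   of alpha under H is alpha^|H| and equals the product of the beta_n^|H|. *)

(** * Extending the absolute values of the rationals to [algC] *)

(** The definition of [local_degree] speaks of completions, but no absolute value is ever extended
    to one. All estimates live in [algC] with the fixed w_p, and a completion is reached only by
    approximation: by rational polynomials in a generator, of degree less than the number of
    embeddings inducing the place. Absolute values must take values in the given [R], so even the
    archimedean one has to be carried over from the norm of [algC]. The norm runs over the orbit and
    not over the group H: the product over H is the power of c_n by the order of the stabiliser of
    alpha_n in H, and its Mahler measure may exceed that of alpha_n. The choice of the m_n-th root
    is immaterial: the estimate holds for every root, and another choice changes the product by a
    root of unity. *)

Section ValuationRing.
Variable F : fieldType.
Implicit Types (A B O : set F) (x y z : F).

Definition subring_set A :=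
  [/\ A 1, forall x y, A x -> A y -> A (x - y) & forall x y, A x -> A y -> A (x * y)].

Section SubringSet.
Variables (A : set F) (ringA : subring_set A).

Lemma subring1 : A 1. Proof. by case: ringA. Qed.
Lemma subringB x y : A x -> A y -> A (x - y). Proof. by case: ringA => _ + _; apply. Qed.
Lemma subringM x y : A x -> A y -> A (x * y). Proof. by case: ringA => _ _; apply. Qed.
Lemma subring0 : A 0. Proof. by rewrite -(subrr 1); apply: subringB; apply: subring1. Qed.
Lemma subringN x : A x -> A (- x).
Proof. by move=> Ax; rewrite -sub0r; apply: subringB => //; apply: subring0. Qed.
Lemma subringD x y : A x -> A y -> A (x + y).
Proof. by move=> Ax Ay; rewrite -[y]opprK; apply/subringB/subringN. Qed.
Lemma subringX x n : A x -> A (x ^+ n).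
Proof.
by move=> Ax; elim: n => [|n IH]; rewrite ?expr0 ?exprS; [exact: subring1|exact: subringM].
Qed.
Lemma subring_sum I (r : seq I) (P : pred I) (f : I -> F) :
  (forall i, P i -> A (f i)) -> A (\sum_(i <- r | P i) f i).
Proof. by move=> Af; elim/big_ind: _ => //; [exact: subring0|exact: subringD]. Qed.
Lemma subring_nat n : A n%:R.
Proof.
elim: n => [|n IH]; first exact: subring0.
by rewrite -natr1; apply: subringD => //; apply: subring1.
Qed.

Definition adjoin_set x : set F :=
  [set y | exists2 P : {poly F}, (forall i, A P`_i) & y = P.[x]].

Lemma subring_adjoin x : subring_set (adjoin_set x).
Proof.
split=> [|_ _ [P AP ->] [Q AQ ->]|_ _ [P AP ->] [Q AQ ->]].
- exists 1; last by rewrite hornerC.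
  by move=> i; rewrite coef1; case: (i == 0%N); [exact: subring1|exact: subring0].
- by exists (P - Q); rewrite ?hornerD ?hornerN // => i; rewrite coefB; apply: subringB.
- exists (P * Q); rewrite ?hornerM // => i; rewrite coefM.
  by apply: subring_sum => j _; apply: subringM.
Qed.

Lemma sub_adjoin_set x : A `<=` adjoin_set x.
Proof.
move=> y Ay; exists y%:P; last by rewrite hornerC.
by move=> i; rewrite coefC; case: (i == 0%N) => //; exact: subring0.
Qed.

Lemma mem_adjoin_set x : adjoin_set x x.
Proof.
exists 'X; last by rewrite hornerX.
by move=> i; rewrite coefX; case: (i == 1%N); [exact: subring1|exact: subring0].
Qed.

End SubringSet.

(* A subring maximal for not containing [1/p] is a valuation ring (Chevalley). *)
Lemma exists_max_subring (A0 : set F) (p : F) : subring_set A0 -> ~ A0 p ->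
  exists O, [/\ subring_set O, ~ O p &
    forall B, subring_set B -> O `<=` B -> ~ B p -> B `<=` O].
Proof.
move=> rA0 A0p.
pose P A := A = set0 \/ (subring_set A /\ ~ A p).
have [|O [PO maxO]] := @Zorn_bigcup F P.
  move=> C CP totC; have [[A [CA nA]]|Cemp] := pselect (exists A, C A /\ A <> set0); last first.
    left; apply/seteqP; split=> // x [A CA Ax].
    by exfalso; apply: Cemp; exists A; split => // A0'; rewrite A0' in Ax.
  have ringC B : C B -> B !=set0 -> subring_set B /\ ~ B p.
    by move=> /CP[->|//] [].
  right; split; last first.
    by move=> [B CB Bp]; case: (ringC B CB) => //; exists p.
  have ring2 x y B B' : C B -> B x -> C B' -> B' y ->
      exists2 D, C D & [/\ subring_set D, D x & D y].
    move=> CB Bx CB' By; case: (totC _ _ CB CB') => sub.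
      exists B' => //; have [] := ringC B' CB'; first by exists y.
      by move=> rB' _; split=> //; apply: sub.
    exists B => //; have [] := ringC B CB; first by exists x.
    by move=> rB _; split=> //; apply: sub.
  split.
  - exists A => //; have /set0P nA' : A != set0 by apply/eqP.
    by have [rA _] := ringC A CA nA'; apply: subring1.
  - move=> x y [B CB Bx] [B' CB' By]; have [D CD [rD Dx Dy]] := ring2 _ _ _ _ CB Bx CB' By.
    by exists D => //; apply: subringB.
  - move=> x y [B CB Bx] [B' CB' By]; have [D CD [rD Dx Dy]] := ring2 _ _ _ _ CB Bx CB' By.
    by exists D => //; apply: subringM.
have neO : O <> set0.
  move=> O0; apply: (maxO A0); last by right.
  rewrite O0 properEneq; split; last by [].
  by apply/eqP => /esym h; have := subring1 rA0; rewrite h.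
have {PO} [rO Op] : subring_set O /\ ~ O p by case: PO.
exists O; split=> // B rB OB Bp; apply: contrapT => nBO.
by apply: (maxO B); [split | right].
Qed.

Section MaximalSubring.
Variables (p : F) (O : set F).
Hypotheses (p0 : p != 0) (rO : subring_set O) (Op : O p) (OpV : ~ O p^-1).
Hypothesis maxO : forall B, subring_set B -> O `<=` B -> ~ B p^-1 -> B `<=` O.

(** The ring O[x] is strictly larger than [O], so by maximality it contains 1/p. *)
Lemma adjoin_max x : ~ O x ->
  exists n (a : nat -> F), (forall i, O (a i)) /\ p^-1 = \sum_(i < n) a i * x ^+ i.
Proof.
move=> Ox; have [|] := pselect (adjoin_set O x p^-1).
  case=> P OP ->; exists (size P), (fun i => P`_i); split=> //.
  exact: horner_coef.
move=> /(maxO (subring_adjoin rO x)) h; case: Ox.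
by apply: h; [exact: sub_adjoin_set | exact: mem_adjoin_set].
Qed.

(** If 1/u were outside [O], then 1/p would be a polynomial in 1/u, and clearing denominators puts
    u^n / p in [O]. Since u^n is 1 modulo p, this puts 1/p itself in [O]. *)
Lemma inv_1sub_max b : O b -> O (1 - p * b)^-1.
Proof.
move=> Ob; set u := 1 - p * b; apply: contrapT => Ou.
have Ou' : O u by apply: subringB (subring1 rO) _ => //; apply: subringM.
have u0 : u != 0 by apply/eqP => u0; apply: Ou; rewrite u0 invr0; apply: subring0.
have [n [a [Oa e]]] := adjoin_max Ou.
have Oc : O (u ^+ n * p^-1).
  rewrite e mulr_sumr; apply: subring_sum => // i _.
  have -> : u ^+ n * (a i * u^-1 ^+ i) = a i * u ^+ (n - i).
    have -> : u ^+ n = u ^+ (n - i) * u ^+ i by rewrite -exprD subnK // ltnW.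
    by rewrite mulrCA exprVn mulfK // expf_neq0.
  by apply: subringM => //; apply: subringX.
have [d Od ud] : exists2 d, O d & u ^+ n = 1 - p * d.
  elim: (n) => [|k [d Od IH]]; first by exists 0; [exact: subring0|rewrite mulr0 subr0].
  exists (b + d * u); last by rewrite exprS IH /u; ring.
  by apply: subringD => //; apply: subringM.
apply: OpV; have -> : p^-1 = u ^+ n * p^-1 + d by rewrite ud; field.
exact: subringD.
Qed.

(* [1] lies in the ideal generated by [p] in the polynomials of degree < n in [x]; when this
   holds for both [x] and [1/x], the degree can be lowered. *)
Let E x n := exists2 a : nat -> F, (forall i, O (a i)) & 1 = p * \sum_(i < n) a i * x ^+ i.

Lemma gen_unit_step x k : x != 0 -> E x k.+1 -> E x^-1 k.+1 -> E x k.
Proof.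
move=> x0 [a Oa ea] [b Ob eb].
(* The relation for 1/x writes the unit [u] as p times a polynomial in 1/x without constant term.
   Multiplying by a_k x^k / u expresses the top term of the relation for x by lower powers of x. *)
pose u := 1 - p * b 0%N.
have Ou : O u^-1 by apply: inv_1sub_max.
have u0 : u != 0.
  apply/eqP => u0; apply: OpV; have -> : p^-1 = b 0%N; last by [].
  by apply: (mulfI p0); rewrite divff //; apply/eqP; rewrite -subr_eq0 -/u u0.
exists (fun i => a i + p * a k * (b (k - i)%N / u)).
  move=> i; apply: subringD => //; apply: subringM => //; apply: subringM => //.
rewrite [LHS]ea big_ord_recr /=; congr (p * _).
under [RHS]eq_bigr do rewrite mulrDl.
rewrite big_split /=; congr (_ + _).
have ub : u = p * \sum_(i < k) b i.+1 * x^-1 ^+ i.+1.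
  by rewrite /u {1}eb big_ord_recl /= expr0 mulr1 mulrDr addrC addKr.
have -> : \sum_(i < k) p * a k * (b (k - i)%N / u) * x ^+ i =
   a k / u * x ^+ k * (p * \sum_(i < k) b i.+1 * x^-1 ^+ i.+1).
  rewrite !mulr_sumr (reindex_inj rev_ord_inj) /=; apply: eq_bigr => i _.
  have lt := ltn_ord i.
  have -> : (k - (k - i.+1) = i.+1)%N by lia.
  have -> : x ^+ k = x ^+ (k - i.+1) * x ^+ i.+1 by rewrite -exprD subnK.
  have : x ^+ i.+1 != 0 by rewrite expf_neq0.
  rewrite exprVn; move: (x ^+ i.+1) (x ^+ _) => s t s0; field.
  by rewrite u0 s0.
by rewrite -ub; field.
Qed.

Lemma max_subring_valuation x : O x \/ O x^-1.
Proof.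
have [->|x0] := eqVneq x 0; first by left; apply: subring0.
apply: contrapT => /not_orP[Ox OxV].
(* Lowering both degrees in turn ends at n = 0, where the relation reads 1 = 0. *)
have noE n : E x n -> E x^-1 n -> False.
  elim: n => [|n IH] Ex EV.
    by case: Ex => a _; rewrite big_ord0 mulr0 => /eqP; rewrite oner_eq0.
  apply: IH; first exact: gen_unit_step.
  by apply: gen_unit_step; rewrite ?invr_eq0 ?invrK.
have toE y n m : (n <= m)%N -> (exists a : nat -> F,
   (forall i, O (a i)) /\ p^-1 = \sum_(i < n) a i * y ^+ i) -> E y m.
  move=> nm [a [Oa e]]; exists (fun i => if (i < n)%N then a i else 0).
    by move=> i; case: ifP => // _; exact: subring0.
  rewrite -(divff p0) e; congr (p * _).
  rewrite (big_ord_widen m (fun i => a i * y ^+ i)) // big_mkcond /=.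
  by apply: eq_bigr => i _; case: ifP; rewrite ?mul0r.
have [n ex] := adjoin_max Ox; have [m ey] := adjoin_max OxV.
by apply: (noE (maxn n m)); [exact: toE (leq_maxl n m) ex|exact: toE (leq_maxr n m) ey].
Qed.

End MaximalSubring.
End ValuationRing.

(** * The p-adic absolute value attached to a valuation ring of [algC] *)

Section PadicValue.
Variables (R : realType) (p : nat) (O : set algC).
Hypotheses (p_pr : prime p) (rO : subring_set O) (OpV : ~ O (p%:R)^-1).
Hypothesis valO : forall x, O x \/ O x^-1.
Hypothesis inv_1subO : forall b, O b -> O (1 - p%:R * b)^-1.
Implicit Types x y z : algC.

Let pC : algC := p%:R.
Let pR : R := p%:R.
Let pC0 : pC != 0. Proof. by rewrite pnatr_eq0 -lt0n prime_gt0. Qed.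
Let pR1 : 1 < pR. Proof. by rewrite ltr1n prime_gt1. Qed.
Let pR0 : 0 < pR. Proof. by apply: lt_trans pR1. Qed.

(** The condition [x != 0] excludes 0, whose inverse is 0 by convention. *)
Definition Ounit x := [/\ x != 0, O x & O x^-1].

Lemma Ounit1 : Ounit 1.
Proof. by split; rewrite ?invr1 ?oner_eq0 //; apply: subring1. Qed.
Lemma OunitM x y : Ounit x -> Ounit y -> Ounit (x * y).
Proof.
move=> [x0 Ox Oxv] [y0 Oy Oyv]; split; rewrite ?mulf_neq0 ?invfM //; exact: subringM.
Qed.
Lemma OunitV x : Ounit x -> Ounit x^-1.
Proof. by move=> [x0 Ox Oxv]; split; rewrite ?invrK ?invr_eq0. Qed.
Lemma OunitX x n : Ounit x -> Ounit (x ^+ n).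
Proof.
by move=> Ux; elim: n => [|n IH]; rewrite ?expr0 ?exprS; [exact: Ounit1|exact: OunitM].
Qed.

Lemma O_p_pow (a : int) : O (pC ^ a) -> 0 <= a.
Proof.
move=> Oa; rewrite leNgt; apply/negP => a0; apply: OpV.
have -> : (p%:R : algC)^-1 = pC ^ a * pC ^ (- a - 1).
  by rewrite -expfzDr // addrA subrr sub0r exprN1.
apply: subringM => //; have : 0 <= - a - 1 by lia.
by case: (- a - 1) => // n _; apply: subringX => //; apply: subring_nat.
Qed.

Lemma Ounit_p_pow (a : int) : Ounit (pC ^ a) -> a = 0.
Proof.
move=> [_ h1]; rewrite invr_expz => /O_p_pow; have := O_p_pow h1; lia.
Qed.

(* The valuation of an algebraic [x] takes rational values: [r] is read off a power of [x] that
   is a unit times a power of [p]. *)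
Definition padic_val x (r : R) := 0 < r /\ exists (k : nat) (a : int),
  [/\ (0 < k)%N, r ^+ k = pR ^ a & Ounit (x ^+ k * pC ^ a)].

Lemma expzX (G : unitRingType) (x : G) (a : int) n : (x ^ a) ^+ n = x ^ (a * n).
Proof. by rewrite exprnP exprz_exp. Qed.

Lemma Ounit_scale x k a n : Ounit (x ^+ k * pC ^ a) ->
  Ounit (x ^+ (k * n) * pC ^ (a * n)).
Proof. by move=> /(OunitX n); rewrite exprMn -exprM expzX. Qed.

Lemma padic_val_neq0 x k (a : int) : (0 < k)%N -> Ounit (x ^+ k * pC ^ a) -> x != 0.
Proof.
move=> k0 [+ _ _]; apply: contraNneq => ->.
by rewrite expr0n eqn0Ngt k0 mul0r.
Qed.

(** Once the exponents of x are made equal, the two relations differ by a power of p that is a unit,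
    hence has exponent 0. *)
Lemma padic_val_uniq x r s : padic_val x r -> padic_val x s -> r = s.
Proof.
move=> [r0 [k [a [k0 ra Ua]]]] [s0 [l [b [l0 sb Ub]]]].
have x0 := padic_val_neq0 k0 Ua.
have ab : a * l = b * k.
  apply/eqP; rewrite -subr_eq0; apply/eqP/Ounit_p_pow.
  have := OunitM (Ounit_scale l Ua) (OunitV (Ounit_scale k Ub)).
  rewrite [(l * k)%N]mulnC invfM mulrACA divff ?expf_neq0 // mul1r.
  by rewrite invr_expz -expfzDr.
have kl0 : (0 < k * l)%N by rewrite muln_gt0 k0.
apply: (pexpIrn kl0); rewrite ?nnegrE ?ltW //=.
by rewrite exprM ra mulnC exprM sb !expzX ab.
Qed.

Lemma padic_valM x y r s : padic_val x r -> padic_val y s -> padic_val (x * y) (r * s).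
Proof.
move=> [r0 [k [a [k0 ra Ua]]]] [s0 [l [b [l0 sb Ub]]]].
split; first exact: mulr_gt0.
exists (k * l)%N, (a * l + b * k); split; first by rewrite muln_gt0 k0.
  by rewrite exprMn exprM ra {1}mulnC exprM sb !expzX -expfzDr // gt_eqF.
have := OunitM (Ounit_scale l Ua) (Ounit_scale k Ub).
by rewrite [(l * k)%N]mulnC mulrACA -exprMn -expfzDr.
Qed.

(** By Bezout some multiple b n equals 1 + a p, which is invertible in [O] by [inv_1subO]. *)
Lemma Ounit_coprime n : coprime p n -> Ounit n%:R.
Proof.
move=> pn; have [n0|n0] := posnP n.
  by move: pn; rewrite n0 /coprime gcdn0 => /eqP p1; move: p_pr; rewrite p1.
have [a _ /dvdnP[b]] := Bezoutl p n0.
rewrite gcdnC (eqP pn) => e.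
have : O (1 - pC * (- a%:R))^-1.
  by apply: inv_1subO; apply: subringN => //; apply: subring_nat.
rewrite mulrN opprK -natrM mulnC -[1]/1%:R -natrD e natrM invfM => h.
have b0 : b != 0%N by apply/eqP => b0; rewrite b0 in e; lia.
split; rewrite ?pnatr_eq0 -?lt0n //; first exact: subring_nat.
have -> : n%:R^-1 = b%:R * (b%:R^-1 / n%:R) :> algC.
  by rewrite mulrA divff ?mul1r // pnatr_eq0.
by apply: subringM => //; apply: subring_nat.
Qed.

Lemma Ounit_nat n : (0 < n)%N -> Ounit (n%:R * pC ^ (- (logn p n)%:Z)).
Proof.
move=> n0; have [m pm e] := pfactor_coprime p_pr n0.
rewrite {1}e natrM natrX -mulrA -invr_expz -exprnP divff ?expf_neq0 // mulr1.
exact: Ounit_coprime.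
Qed.

Lemma OunitN x : Ounit x -> Ounit (- x).
Proof. by move=> [x0 Ox Oxv]; split; rewrite ?oppr_eq0 ?invrN //; exact: subringN. Qed.

Lemma Ounit_int (m : int) : m != 0 -> Ounit (m%:~R * pC ^ (- (logn p `|m|)%:Z)).
Proof.
move=> m0; have := @Ounit_nat `|m|%N; rewrite absz_gt0 => /(_ m0).
by case: (m) => n //= /OunitN; rewrite -mulNr NegzE mulrNz.
Qed.

Lemma Ounit_rat (q : rat) : q != 0 -> exists2 a : int,
  Ounit (ratr q * pC ^ a) & rat_abs R (Some p) q = pR ^ a.
Proof.
move=> q0; exists ((logn p `|denq q|)%:Z - (logn p `|numq q|)%:Z).
  have := OunitM (@Ounit_int (numq q) _) (OunitV (@Ounit_int (denq q) _)).
  rewrite numq_eq0 denq_eq0 => /(_ q0 isT).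
  rewrite invfM mulrACA invr_expz opprK /ratr => h.
  by rewrite expfzDr // [pC ^ _ * _]mulrC.
by rewrite /rat_abs (negPf q0) expfzDr ?gt_eqF // -invr_expz.
Qed.

Lemma padic_val_rat (q : rat) : q != 0 -> padic_val (ratr q) (rat_abs R (Some p) q).
Proof.
move=> /Ounit_rat[a Ua ea]; split; first by rewrite ea exprz_gt0.
by exists 1%N, a; rewrite !expr1.
Qed.

Definition Omax x := O x /\ ~ Ounit x.

(** One of x/y and y/x lies in [O], say x/y; an invertible sum would then make y invertible. *)
Lemma OmaxD x y : Omax x -> Omax y -> Omax (x + y).
Proof.
suff main x' y' : O (x' / y') -> Omax x' -> Omax y' -> Omax (x' + y').
  move=> mx my; have [h|] := valO (x / y); first exact: main.
  by rewrite invf_div addrC => h; apply: main.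
move=> Oq [Ox Ux] [Oy Uy]; split; first exact: subringD.
have [y0|y0] := eqVneq y' 0; first by rewrite y0 addr0.
move=> [s0 Os OsV]; apply: Uy; split=> //.
have -> : y'^-1 = (x' + y')^-1 * (x' / y' + 1) by field; rewrite s0 y0.
by apply: subringM => //; apply: subringD => //; apply: subring1.
Qed.

Lemma Omax_sum I (r : seq I) (P : pred I) (f : I -> algC) :
  (forall i, P i -> Omax (f i)) -> Omax (\sum_(i <- r | P i) f i).
Proof.
move=> h; elim/big_ind: _ => //; last exact: OmaxD.
by split; [exact: subring0 | case; rewrite eqxx].
Qed.

Lemma max_term (I : finType) (t : I -> algC) (i0 : I) : t i0 != 0 ->
  exists2 i, t i != 0 & forall j, O (t j / t i).
Proof.
move=> ti0; suff : forall s : seq I, exists2 i, t i != 0 & forall j, j \in s -> O (t j / t i).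
  by move=> /(_ (enum I))[i ti h]; exists i => // j; apply: h; rewrite mem_enum.
elim=> [|k s [i ti IH]]; first by exists i0.
have [h|] := valO (t k / t i).
  by exists i => // j; rewrite inE => /predU1P[->|/IH].
rewrite invf_div => h.
have [tk|tk] := eqVneq (t k) 0.
  exists i => // j; rewrite inE => /predU1P[->|/IH//].
  by rewrite tk mul0r; exact: subring0.
exists k => // j; rewrite inE => /predU1P[->|/IH js].
  by rewrite divff //; exact: subring1.
have -> : t j / t k = (t j / t i) * (t i / t k) by field; rewrite ti tk.
exact: subringM.
Qed.

(** The largest value in a vanishing sum is attained twice: otherwise dividing by the largest term
    would write -1 as a sum of non-units. *)
Lemma sum0_two_terms (I : finType) (t : I -> algC) (i0 : I) : t i0 != 0 ->
  \sum_i t i = 0 -> exists i j, [/\ i != j, t i != 0, t j != 0 & Ounit (t j / t i)].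
Proof.
move=> ti0 sum0; have [i ti h] := max_term ti0; exists i; apply: contrapT => no.
have : Omax (\sum_(j | j != i) t j / t i).
  apply: Omax_sum => j ji; split=> // Uj; apply: no; exists j; split=> //.
    by rewrite eq_sym.
  by case: Uj => + _ _; apply: contraNneq => ->; rewrite mul0r.
rewrite -mulr_suml; move: sum0; rewrite (bigD1 i) //= => /eqP.
rewrite addrC addr_eq0 => /eqP ->; rewrite mulNr divff // => -[_]; apply.
exact/OunitN/Ounit1.
Qed.

(** Two terms of the minimal polynomial at x have the same value. Their quotient shows that a power
    of x is a unit times a rational number, which fixes the value of x as a rational power of p. *)
Lemma padic_val_ex x : x != 0 -> exists r, padic_val x r.
Proof.
move=> x0; have [f [_ fmon] /(_ f)] := minCpolyP x.
rewrite dvdpp => /rootP; rewrite horner_coef.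
set n := size _ => fx.
have n0 : (0 < n)%N by rewrite /n size_map_poly size_poly_gt0 monic_neq0.
pose t (i : 'I_n) := (map_poly ratr f)`_i * x ^+ i.
have n1 : (n.-1 < n)%N by rewrite prednK.
have [|i [j [ij ti tj U]]] := @sum0_two_terms _ t (Ordinal n1) _ fx.
  rewrite /t mulf_neq0 ?expf_neq0 //=.
  by rewrite -[_`__]/(lead_coef _) (monicP _) ?oner_eq0 // map_monic.
have {U} [k [l [kl tk tl U]]] :
    exists k l : 'I_n, [/\ (k < l)%N, t k != 0, t l != 0 & Ounit (t l / t k)].
  case: (ltngtP i j) => [lt|lt|e]; first by exists i, j.
    by exists j, i; split=> //; rewrite -invf_div; apply: OunitV.
  by move: ij; rewrite -val_eqE /= e eqxx.
have ct m : t m != 0 -> f`_m != 0.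
  by apply: contraNneq => e; rewrite /t coef_map e /= rmorph0 mul0r.
have [a Ua _] := Ounit_rat (ct _ tk); have [b Ub _] := Ounit_rat (ct _ tl).
have Ux : Ounit (x ^+ (l - k) * pC ^ (a - b)).
  have := OunitM U (OunitM Ua (OunitV Ub)).
  rewrite /t !coef_map /=.
  have -> : x ^+ l = x ^+ (l - k) * x ^+ k by rewrite -exprD subnK // ltnW.
  have -> // : ratr f`_l * (x ^+ (l - k) * x ^+ k) / (ratr f`_k * x ^+ k) *
    (ratr f`_k * pC ^ a / (ratr f`_l * pC ^ b)) = x ^+ (l - k) * pC ^ (a - b).
  rewrite expfzDr // -invr_expz.
  have : ratr f`_k != 0 :> algC by rewrite fmorph_eq0 ct.
  have : ratr f`_l != 0 :> algC by rewrite fmorph_eq0 ct.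
  have : pC ^ b != 0 by rewrite expfz_neq0.
  have : x ^+ k != 0 by rewrite expf_neq0.
  move: (x ^+ k) (pC ^ b) (ratr _) (ratr _) => u1 u2 u3 u4 h1 h2 h3 h4.
  by field; rewrite ?h1 ?h2 ?h3 ?h4.
exists (powR pR ((a - b)%:~R / (l - k)%:R)); split; first exact: powR_gt0.
exists (l - k)%N, (a - b); split=> //; first by rewrite subn_gt0.
have lk0 : (l - k)%:R != 0 :> R by rewrite pnatr_eq0 -lt0n subn_gt0.
by rewrite -powR_mulrn ?powR_ge0 // -powRrM divfK // powR_intmul.
Qed.

Lemma padic_val_le1 x r : padic_val x r -> (r <= 1) <-> O x.
Proof.
move=> [r0 [k [a [k0 ra Ua]]]]; split=> [r1|Ox].
  have a0 : a <= 0.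
    rewrite leNgt; apply/negP => a0; have : r ^+ k <= 1 by rewrite exprn_ile1 // ltW.
    rewrite ra; case: a a0 {ra Ua} => // n n0; rewrite -exprnP leNgt.
    by rewrite exprn_egt1 //; case: n n0.
  have Oxk : O (x ^+ k).
    have -> : x ^+ k = x ^+ k * pC ^ a * pC ^ (- a).
      by rewrite -mulrA -expfzDr // subrr mulr1.
    apply: subringM; [exact: rO|by case: Ua|].
    have : 0 <= - a by lia.
    by case: (- a) => // n _; apply: subringX => //; exact: subring_nat.
  have [//|OxV] := valO x.
  (* Integral closedness in the form needed: if x^k and 1/x are in [O], so is x. *)
  have -> : x = x ^+ k * x^-1 ^+ k.-1.
    rewrite -{1}(prednK k0) exprS exprVn mulfK // expf_neq0 //.
    exact: padic_val_neq0 Ua.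
  by apply: subringM => //; apply: subringX.
have : O (pC ^ (- a)).
  have [u0 _ OuV] := Ua.
  have -> : pC ^ (- a) = (x ^+ k * pC ^ a)^-1 * x ^+ k.
    rewrite -invr_expz.
    have : x ^+ k != 0 by rewrite expf_neq0 // (padic_val_neq0 k0 Ua).
    have : pC ^ a != 0 by rewrite expfz_neq0.
    by move: (x ^+ k) (pC ^ a) => u v hu hv; field; rewrite hu hv.
  by apply: subringM => //; apply: subringX.
move=> /O_p_pow a0; rewrite -(expr_le1 k0 (ltW r0)) ra.
have -> : pR ^ a = (pR ^ (- a))^-1 by rewrite invr_expz opprK.
case: (- a) a0 => // n _; rewrite invf_le1 ?exprz_gt0 // -exprnP.
by rewrite exprn_ege1 // ltW.
Qed.

Definition padic_fun x : R := if x == 0 then 0 else xget 0 (padic_val x).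

Lemma padic_funP x : x != 0 -> padic_val x (padic_fun x).
Proof.
move=> x0; rewrite /padic_fun (negPf x0); case: xgetP => // /= no.
by case: (padic_val_ex x0) => r /no.
Qed.

Lemma padic_fun0 : padic_fun 0 = 0. Proof. by rewrite /padic_fun eqxx. Qed.

Lemma padic_fun_gt0 x : x != 0 -> 0 < padic_fun x.
Proof. by move=> /padic_funP[]. Qed.

Lemma padic_fun_ge0 x : 0 <= padic_fun x.
Proof. by have [->|/padic_fun_gt0/ltW//] := eqVneq x 0; rewrite padic_fun0. Qed.

Lemma padic_fun_eq0 x : (padic_fun x == 0) = (x == 0).
Proof.
have [->|x0] := eqVneq x 0; first by rewrite padic_fun0 eqxx.
by rewrite gt_eqF // padic_fun_gt0.
Qed.

Lemma padic_funM x y : padic_fun (x * y) = padic_fun x * padic_fun y.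
Proof.
have [->|x0] := eqVneq x 0; first by rewrite mul0r padic_fun0 mul0r.
have [->|y0] := eqVneq y 0; first by rewrite mulr0 padic_fun0 mulr0.
apply: (@padic_val_uniq (x * y)); first by apply: padic_funP; rewrite mulf_neq0.
by apply: padic_valM; apply: padic_funP.
Qed.

Lemma padic_fun_le1 x : padic_fun x <= 1 <-> O x.
Proof.
have [->|x0] := eqVneq x 0; last exact/padic_val_le1/padic_funP.
by rewrite padic_fun0; split=> _; [exact: subring0|exact: ler01].
Qed.

Lemma padic_fun_ultra x y : padic_fun (x + y) <= Num.max (padic_fun x) (padic_fun y).
Proof.
wlog le : x y / padic_fun x <= padic_fun y.
  move=> H; case/orP: (le_total (padic_fun x) (padic_fun y)) => /H // h.
  by rewrite maxC addrC.
rewrite (max_idPr le); have [y0|y0] := eqVneq y 0.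
  move: le; rewrite y0 padic_fun0 => le.
  have /eqP : padic_fun x == 0 by rewrite eq_le le padic_fun_ge0.
  by move/eqP; rewrite padic_fun_eq0 => /eqP ->; rewrite addr0 padic_fun0.
have -> : x + y = (x / y + 1) * y by field.
rewrite padic_funM ler_piMl ?padic_fun_ge0 //; apply/padic_fun_le1.
apply: subringD => //; last exact: subring1.
apply/padic_fun_le1; rewrite -(ler_pM2r (padic_fun_gt0 y0)) -padic_funM divfK //.
by rewrite mul1r.
Qed.

Lemma padic_fun_triangle x y : padic_fun (x + y) <= padic_fun x + padic_fun y.
Proof.
apply: le_trans (padic_fun_ultra x y) _.
by rewrite ge_max lerDl lerDr !padic_fun_ge0.
Qed.

Definition padic_absval : absval R algC :=
  AbsVal padic_fun_ge0 padic_fun_eq0 padic_funM padic_fun_triangle.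

Lemma padic_absval_rat q : padic_absval (ratr q) = rat_abs R (Some p) q.
Proof.
have [->|q0] := eqVneq q 0; first by rewrite rmorph0 /= padic_fun0.
apply: (@padic_val_uniq (ratr q)); last exact: padic_val_rat.
by apply: padic_funP; rewrite fmorph_eq0.
Qed.

End PadicValue.

Definition ultrametric (R : realType) (F : fieldType) (v : absval R F) :=
  forall x y, v (x + y) <= Num.max (v x) (v y).

Lemma exists_padic_absval (R : realType) p : prime p ->
  exists2 w : absval R algC, ultrametric w & forall q, w (ratr q) = rat_abs R (Some p) q.
Proof.
move=> p_pr.
have pC0 : p%:R != 0 :> algC by rewrite pnatr_eq0 -lt0n prime_gt0.
(* Seed of the maximal subring: the image of the integers, which does not contain 1/p. *)
pose Z := range (fun m : int => m%:~R : algC).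
have rZ : subring_set Z.
  split; first by exists 1.
    by move=> _ _ [m _ <-] [n _ <-]; exists (m - n) => //; rewrite rmorphB.
  by move=> _ _ [m _ <-] [n _ <-]; exists (m * n) => //; rewrite rmorphM.
have ZpV : ~ Z p%:R^-1.
  move=> [m _ e]; have : (p%:Z * m)%:~R = 1%:~R :> algC by rewrite rmorphM /= e divff.
  move=> /intr_inj /(congr1 absz) /eqP; rewrite abszM muln_eq1 absz_nat => /andP[/eqP p1 _].
  by move: p_pr; rewrite p1.
have [O [rO OpV maxO]] := exists_max_subring rZ ZpV.
have Op : O p%:R by exact: subring_nat.
have valO := max_subring_valuation pC0 rO Op OpV maxO.
have invO := inv_1sub_max pC0 rO Op OpV maxO.
exists (padic_absval R p_pr rO OpV valO invO).
  exact: (padic_fun_ultra R p_pr rO OpV valO invO).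
exact: padic_absval_rat.
Qed.

(** * The archimedean absolute value of [algC] with values in [R] *)

Section RealCut.
Variable R : realType.
Implicit Types x y : algC.

(** The norm of [algC] has its values in [algC]; its rational Dedekind cuts carry them to [R]. *)
Definition cut x : set R := [set ratr q | q in [set q : rat | ratr q <= x]].
(* Only meaningful for [0 <= x]: [algC] is ordered but not totally. *)
Definition cut_real x : R := sup (cut x).

Lemma cut_real_ge q x : ratr q < x -> ratr q <= cut_real x.
Proof.
move=> qx; apply: sup_upper_bound; last by exists q => //=; apply: ltW.
split; first by exists (ratr q), q => //=; apply: ltW.
have xr : x \is Num.real.
  have := ltW qx; rewrite -subr_ge0 => /ger0_real; rewrite -{2}(subrK (ratr q) x) => h.
  by rewrite rpredD // rpred_rat.
exists (Num.bound `|x|)%:R => _ [s /= sx <-].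
rewrite -ratr_nat ler_rat -(ler_rat algC) ratr_nat.
apply: le_trans sx (le_trans (real_ler_norm xr) _).
by rewrite ltW // archi_boundP // normr_ge0.
Qed.

Lemma cut_real_le q x : 0 <= x -> x < ratr q -> cut_real x <= ratr q.
Proof.
move=> x0 xq; apply: ge_sup; first by exists 0, 0; rewrite /= ?rmorph0.
move=> _ [s /= sx <-]; rewrite ler_rat -(ler_rat algC).
exact: le_trans sx (ltW xq).
Qed.

Lemma cut_real_rat q : 0 <= q -> cut_real (ratr q) = ratr q.
Proof.
move=> q0; apply/eqP; rewrite eq_le; apply/andP; split.
  apply: ge_sup; first by exists 0, 0; rewrite /= ?rmorph0 // ler0q.
  by move=> _ [s /= sx <-]; rewrite ler_rat -(ler_rat algC).
apply: sup_upper_bound; last by exists q => /=.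
split; first by exists (ratr q), q => /=.
by exists (ratr q) => _ [s /= sx <-]; rewrite ler_rat -(ler_rat algC).
Qed.

Lemma cut_real_ge0 x : 0 <= x -> 0 <= cut_real x.
Proof.
rewrite le_eqVlt => /predU1P[<-|x0].
  by rewrite -(rmorph0 (ratr : rat -> algC)) cut_real_rat // rmorph0.
by rewrite -(rmorph0 (ratr : rat -> R)); apply: cut_real_ge; rewrite rmorph0.
Qed.

Lemma cut_real_lt_rat q x : 0 <= x -> cut_real x < ratr q -> x <= ratr q.
Proof.
move=> x0 xq; rewrite real_leNgt ?rpred_rat ?(ger0_real x0) //.
by apply/negP => /cut_real_ge; rewrite leNgt xq.
Qed.

Lemma rat_lt_cut_real q x : 0 <= x -> ratr q < cut_real x -> ratr q <= x.
Proof.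
move=> x0 xq; rewrite real_leNgt ?rpred_rat ?(ger0_real x0) //.
by apply/negP => /(cut_real_le x0); rewrite leNgt xq.
Qed.

Lemma rat_between (a b : R) : a < b -> exists q : rat, a < ratr q < b.
Proof. by move=> /rat_in_itvoo[q]; rewrite in_itv; exists q. Qed.

Lemma cut_real_leD x y z : 0 <= x -> 0 <= y -> 0 <= z -> z <= x + y ->
  cut_real z <= cut_real x + cut_real y.
Proof.
move=> x0 y0 z0 zxy; rewrite leNgt; apply/negP => lt.
set d := cut_real z - (cut_real x + cut_real y).
have d0 : 0 < d by rewrite subr_gt0.
have [|q /andP[q1 q2]] := @rat_between (cut_real x) (cut_real x + d / 2); first by lra.
have [|s /andP[s1 s2]] := @rat_between (cut_real y) (cut_real y + d / 2); first by lra.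
have xq := cut_real_lt_rat x0 q1; have ys := cut_real_lt_rat y0 s1.
have : ratr (q + s) < cut_real z.
  by rewrite rmorphD /=; have : cut_real z = cut_real x + cut_real y + d; [rewrite /d; ring|lra].
have [|t /andP[t1 t2] _] := @rat_between (ratr (q + s)) (cut_real z).
  by rewrite rmorphD /=; have : cut_real z = cut_real x + cut_real y + d; [rewrite /d; ring|lra].
have := rat_lt_cut_real z0 t2.
move: t1; rewrite ltr_rat -(ltr_rat algC) rmorphD /= => t1.
move=> /(lt_le_trans t1)/lt_le_trans /(_ zxy).
by rewrite le_gtF // lerD.
Qed.

Lemma cut_realM x y : 0 <= x -> 0 <= y -> cut_real (x * y) = cut_real x * cut_real y.
Proof.
move=> x0 y0.
have xy0 : 0 <= x * y by rewrite mulr_ge0.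
have X0 := cut_real_ge0 x0; have Y0 := cut_real_ge0 y0.
have rat0 (a : R) (q : rat) : 0 <= a -> a < ratr q -> 0 < q.
  by move=> a0 h; rewrite -(ltr0q R); apply: le_lt_trans h.
apply/eqP; rewrite eq_le; apply/andP; split; rewrite leNgt; apply/negP => lt.
  have [e e0 he] : exists2 e, 0 < e &
     (cut_real x + e) * (cut_real y + e) < cut_real (x * y).
    set X := cut_real x; set Y := cut_real y; set D := cut_real (x * y) - X * Y.
    have D0 : 0 < D by rewrite subr_gt0.
    have k0 : 0 < X + Y + 1 + D by rewrite /X /Y; lra.
    (* With e < 1 the excess of (X + e)(Y + e) over XY is less than e (X + Y + 1), which is at most
       D / 2. *)
    exists (D / (X + Y + 1 + D) / 2); first by rewrite !divr_gt0.
    set e := D / _ / 2.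
    have e0 : 0 < e by rewrite !divr_gt0.
    have eD : 2 * e * (X + Y + 1 + D) = D by rewrite /e; field; rewrite gt_eqF.
    have e1 : e < 1 by rewrite -/X -/Y in X0 Y0; nra.
    have : cut_real (x * y) = X * Y + D by rewrite /D; ring.
    by rewrite -/X -/Y in X0 Y0; nra.
  have [|q /andP[q1 q2]] := @rat_between (cut_real x) (cut_real x + e); first by lra.
  have [|s /andP[s1 s2]] := @rat_between (cut_real y) (cut_real y + e); first by lra.
  have xq := cut_real_lt_rat x0 q1; have ys := cut_real_lt_rat y0 s1.
  have [|t /andP[t1 t2]] := @rat_between (ratr (q * s)) (cut_real (x * y)).
    apply: le_lt_trans he; rewrite rmorphM ler_pM ?ler0q ?ltW //.
      exact: rat0 q1.
    exact: rat0 s1.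
  have := rat_lt_cut_real xy0 t2.
  move: t1; rewrite ltr_rat -(ltr_rat algC) rmorphM /= => t1 /(lt_le_trans t1).
  by rewrite le_gtF // ler_pM.
have [XP YP] : 0 < cut_real x /\ 0 < cut_real y.
  have : 0 < cut_real x * cut_real y by apply: le_lt_trans lt; apply: cut_real_ge0.
  by rewrite !lt_def X0 Y0 !andbT mulf_eq0 negb_or => /andP[/andP[]].
set X := cut_real x in lt X0 XP *; set Y := cut_real y in lt Y0 YP *.
(* The rational t lies strictly between the cut of xy and XY. Rationals q < X and s < Y with t < qs
   then give t < qs <= xy, against xy <= t. *)
have [t /andP[t1 t2]] := rat_between lt.
have t0 : 0 < t by apply: rat0 t1; apply: cut_real_ge0.
have [|q /andP[q1 q2]] := @rat_between (ratr t / Y) X.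
  by rewrite ltr_pdivrMr.
have tY : 0 <= ratr t / Y by rewrite divr_ge0 ?ler0q ?ltW.
have q0 := rat0 _ _ tY q1.
have [|s /andP[s1 s2]] := @rat_between (ratr t / ratr q) Y.
  by rewrite ltr_pdivrMr ?ltr0q // mulrC -ltr_pdivrMr.
have tq : 0 <= ratr t / ratr q :> R by rewrite divr_ge0 ?ler0q ?ltW.
have s0 := rat0 _ _ tq s1.
have qx := rat_lt_cut_real x0 q2; have sy := rat_lt_cut_real y0 s2.
have := cut_real_lt_rat xy0 t1.
move: s1; rewrite ltr_pdivrMr ?ltr0q // -rmorphM ltr_rat -(ltr_rat algC) mulrC rmorphM /=.
move=> lt1 le1; have := le_lt_trans le1 lt1.
by rewrite le_gtF // ler_pM // ler0q ltW.
Qed.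

Definition arch_fun x : R := cut_real `|x|.

Lemma arch_fun_ge0 x : 0 <= arch_fun x. Proof. exact: cut_real_ge0. Qed.

Lemma arch_funM x y : arch_fun (x * y) = arch_fun x * arch_fun y.
Proof. by rewrite /arch_fun normrM cut_realM. Qed.

Lemma arch_fun_rat q : arch_fun (ratr q) = `|ratr q|.
Proof. by rewrite /arch_fun -ratr_norm cut_real_rat // ratr_norm. Qed.

Lemma arch_fun_eq0 x : (arch_fun x == 0) = (x == 0).
Proof.
have [->|x0] := eqVneq x 0.
  by rewrite -(rmorph0 (ratr : rat -> algC)) arch_fun_rat rmorph0 normr0 eqxx.
apply/eqP => h; have := arch_fun_rat 1.
rewrite rmorph1 -(divff x0) arch_funM h mul0r rmorph1 normr1 => /esym/eqP.
by rewrite oner_eq0.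
Qed.

Lemma arch_fun_triangle x y : arch_fun (x + y) <= arch_fun x + arch_fun y.
Proof. by apply: cut_real_leD => //; apply: ler_normD. Qed.

Definition arch_absval : absval R algC :=
  AbsVal arch_fun_ge0 arch_fun_eq0 arch_funM arch_fun_triangle.

End RealCut.

(** * Weak approximation *)

Definition ev (P : nat -> Prop) := exists N, forall n, (N <= n)%N -> P n.

Lemma ev_and P Q : ev P -> ev Q -> ev (fun n => P n /\ Q n).
Proof.
move=> [N hN] [M hM]; exists (maxn N M) => n; rewrite geq_max => /andP[? ?].
by split; [apply: hN|apply: hM].
Qed.

Lemma ev_imp (P Q : nat -> Prop) : (forall n, P n -> Q n) -> ev P -> ev Q.
Proof. by move=> PQ [N hN]; exists N => n /hN/PQ. Qed.

Lemma ev_all (T : eqType) (s : seq T) (P : T -> nat -> Prop) :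
  (forall t, t \in s -> ev (P t)) -> ev (fun n => forall t, t \in s -> P t n).
Proof.
elim: s => [|a s IH] h; first by exists 0%N.
have /IH h' : forall t, t \in s -> ev (P t) by move=> t ts; apply: h; rewrite inE ts orbT.
have := ev_and (h a (mem_head _ _)) h'; apply: ev_imp => n [Pa Ps] t.
by rewrite inE => /predU1P[->|/Ps].
Qed.

Lemma ev_ex P : ev P -> exists n, P n.
Proof. by move=> [N]; exists N; auto. Qed.

Lemma ev_powers_large (R : realType) (c A : R) : 1 < c -> ev (fun n => A < c ^+ n).
Proof.
move=> c1; have bern n : 1 + n%:R * (c - 1) <= c ^+ n.
  elim: n => [|n IH]; first by rewrite mul0r addr0 expr0.
  rewrite exprS -natr1.
  have h0 : 0 <= n%:R * (c - 1) ^+ 2 by rewrite mulr_ge0 // sqr_ge0.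
  have : c * (1 + n%:R * (c - 1)) <= c * c ^+ n by rewrite ler_pM2l //; lra.
  nra.
have c0 : 0 < c - 1 by lra.
exists (Num.bound (`|A| / (c - 1))) => n le.
apply: lt_le_trans (bern n); apply: le_lt_trans (real_ler_norm (num_real A)) _.
apply: (@lt_le_trans _ _ (n%:R * (c - 1))); last by lra.
rewrite -ltr_pdivrMr //; apply: lt_le_trans (archi_boundP _) _; first by rewrite divr_ge0 // ltW.
by rewrite ler_nat.
Qed.

Lemma ev_powers_small (R : realType) (c e : R) :
  0 <= c -> c < 1 -> 0 < e -> ev (fun n => c ^+ n < e).
Proof.
move=> c0 c1 e0; move: c0; rewrite le_eqVlt => /predU1P[<-|c0].
  by exists 1%N => -[|n] // _; rewrite expr0n.
have := @ev_powers_large R c^-1 e^-1; rewrite invf_gt1 // => /(_ c1).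
by apply: ev_imp => n; rewrite exprVn ltf_pV2 // posrE ?exprn_gt0.
Qed.

Section WeakApproximation.
Variables (R : realType) (F : fieldType).
Implicit Types (u v w : absval R F) (x y b : F).

Lemma absval_eq u v : (forall x, u x = v x) -> u = v.
Proof.
case: u v => [f a1 a2 a3 a4] [g b1 b2 b3 b4] /= /funext e; subst g.
by congr AbsVal; exact: Prop_irrelevance.
Qed.

Lemma absvX v x n : v (x ^+ n) = v x ^+ n.
Proof. by elim: n => [|n IH]; rewrite ?absv1 // !exprS absvM IH. Qed.

Lemma absv_gt0 v x : x != 0 -> 0 < v x.
Proof. by move=> x0; rewrite lt_def absv_eq0 x0 absv_ge0. Qed.

Lemma absv_sum v I (r : seq I) (P : pred I) (f : I -> F) :
  v (\sum_(i <- r | P i) f i) <= \sum_(i <- r | P i) v (f i).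
Proof.
elim/big_rec2: _ => [|i y1 y2 _ le]; first by rewrite absv0.
by apply: le_trans (absv_triangle _ _ _) _; rewrite lerD2l.
Qed.

Lemma absv_prod v I (r : seq I) (P : pred I) (f : I -> F) :
  v (\prod_(i <- r | P i) f i) = \prod_(i <- r | P i) v (f i).
Proof. by elim/big_rec2: _ => [|i y1 y2 _ <-]; rewrite ?absv1 ?absvM. Qed.

(* If [u x < v x], a power of [x] can be scaled by a power of [c] so that 1 falls in between. *)
Lemma absv_separate u v c : u c = v c -> 1 < u c -> u != v ->
  exists2 x, u x < 1 & 1 < v x.
Proof.
move=> ec c1 /eqP uv.
have c0 : c != 0 by rewrite -(absv_eq0 u) gt_eqF //; lra.
have [x x0 lt] : exists2 x, x != 0 & u x < v x.
  have /existsNP[x /eqP ux] : ~ (forall x, u x = v x) by move=> /absval_eq.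
  have x0 : x != 0 by apply: contraNneq ux => ->; rewrite !absv0.
  have [lt|gt] := ltP (u x) (v x); first by exists x.
  exists x^-1; rewrite ?invr_eq0 // !absvV // ltf_pV2 ?posrE ?absv_gt0 //.
  by rewrite lt_def ux gt.
have [m hm] := ev_ex (ev_powers_large (u x)^-1 c1).
pose y := x * c ^+ m.
have uy1 : 1 < u y.
  rewrite absvM absvX -(@mulfV _ (u x)) ?absv_eq0 //.
  by rewrite ltr_pM2l ?absv_gt0.
have uvy : u y < v y by rewrite !absvM !absvX -ec ltr_pM2r // exprn_gt0 //; lra.
have uy0 : 0 < u y by lra.
(* The n-th powers of [u y] and [v y] are now more than a factor [u c] apart, so some power of [u c]
   falls between them. *)
have [n hn] : exists n, u c < (v y / u y) ^+ n.
  by apply/ev_ex/ev_powers_large; rewrite ltr_pdivlMr // mul1r.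
have [k0 hk0] := ev_ex (ev_powers_large (u y ^+ n) c1).
have exk : exists k, u y ^+ n < u c ^+ k by exists k0.
case: (ex_minnP exk) => -[|k] hk mink.
  by move: hk; rewrite expr0 ltNge exprn_ege1 // ltW.
have le_k : u c ^+ k <= u y ^+ n.
  by rewrite leNgt; apply/negP => /mink; rewrite ltnn.
have ck0 : c ^+ k.+1 != 0 by rewrite expf_neq0.
exists (y ^+ n / c ^+ k.+1); rewrite absvM absvV // !absvX.
  by rewrite ltr_pdivrMr ?mul1r // exprn_gt0 //; lra.
rewrite -ec ltr_pdivlMr ?mul1r; last by rewrite exprn_gt0 //; lra.
rewrite exprS; apply: le_lt_trans (_ : u c * u y ^+ n < _).
  by rewrite ler_pM2l //; lra.
by rewrite -ltr_pdivlMr ?exprn_gt0 // -expr_div_n.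
Qed.

(** As n grows, [T b n] tends to 0 where b has absolute value less than 1, and to 1 where it is
    greater than 1. *)
Let T b n := b ^+ n / (1 + b ^+ n).

Lemma ev_approx0 v b e : v b < 1 -> 0 < e -> ev (fun n => v (T b n) < e).
Proof.
move=> vb e0; have d0 : 0 < e / (1 + e) by rewrite divr_gt0 //; lra.
apply: ev_imp (ev_powers_small (absv_ge0 v b) vb d0) => n.
rewrite -absvX /T; set z := b ^+ n => hz.
have z1 : v z < 1 by apply: lt_trans hz _; rewrite ltr_pdivrMr ?mul1r; lra.
have lt1 : 1 - v z <= v (1 + z).
  by have := absv_rev v 1 (- z); rewrite opprK absvN absv1.
have nz : 1 + z != 0 by rewrite -(absv_eq0 v) gt_eqF //; lra.
rewrite absvM absvV // ltr_pdivrMr ?absv_gt0 //.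
move: hz; rewrite ltr_pdivlMr; last lra.
nra.
Qed.

Lemma ev_approx1 v b e : 1 < v b -> 0 < e -> ev (fun n => v (T b n - 1) < e).
Proof.
move=> vb e0; apply: ev_imp (ev_powers_large (1 + e^-1) vb) => n.
rewrite -absvX /T; set z := b ^+ n => hz.
have i0 : 0 < e^-1 by rewrite invr_gt0.
have lt1 : v z - 1 <= v (1 + z).
  by have := absv_rev v z (- 1); rewrite opprK absvN absv1 [z + 1]addrC.
have nz : 1 + z != 0 by rewrite -(absv_eq0 v) gt_eqF //; lra.
have -> : z / (1 + z) - 1 = - (1 + z)^-1 by field.
rewrite absvN absvV // -[e]invrK ltf_pV2 ?posrE ?absv_gt0 //; lra.
Qed.

(** Induction on the list: b already serves [v] and [s], while c serves [v] and the new [w].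
    According to the size of [w b], either b itself works, or c does after a correction by b that
    shrinks it on [s]. *)
Lemma dominate v (s : seq (absval R F)) :
  (exists c, 1 < v c) ->
  (forall u, u \in s -> exists2 c, u c < 1 & 1 < v c) ->
  exists2 b, 1 < v b & forall u, u \in s -> u b < 1.
Proof.
move=> [c0 hc0]; elim: s => [|w s IH] h; first by exists c0.
have [|b vb sb] := IH; first by move=> u us; apply: h; rewrite inE us orbT.
have [c wc vc] := h w (mem_head _ _).
have [lt|gt|eq] := ltgtP (w b) 1.
- by exists b => // u; rewrite inE => /predU1P[->|/sb].
(* Here [w b] exceeds 1, so multiplying by [T b n] hardly changes c at [v] and [w] but makes it
   small on [s]. The thresholds keep the products on the right side of 1; if [w c] is 0, any bound
   will do. *)
- have [n [h1 [h2 h3]]] : exists n, v (T b n - 1) < 1 - (v c)^-1 /\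
      (w (T b n - 1) < (if w c == 0 then 1 else (w c)^-1 - 1) /\
      forall u, u \in s -> u (T b n) < (1 + u c)^-1).
    apply/ev_ex/ev_and.
      by apply: ev_approx1 => //; rewrite subr_gt0 invf_lt1 //; lra.
    apply: ev_and.
      apply: ev_approx1 => //; case: eqVneq => [//|wc0].
      by rewrite subr_gt0 invf_gt1 // lt_def wc0 absv_ge0.
    apply: ev_all => u us; apply: ev_approx0; first exact: sb.
    by rewrite invr_gt0; have := absv_ge0 u c; lra.
  exists (c * T b n).
    rewrite absvM; have := absv_rev v 1 (1 - T b n).
    rewrite absv1 subKr => h4.
    have {}h1 : v (1 - T b n) < 1 - (v c)^-1 by rewrite -absvN opprB.
    have vc0 : 0 < v c by lra.
    have h5 : (v c)^-1 < v (T b n) by lra.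
    by move: h5; rewrite -(ltr_pM2l vc0 (v c)^-1) divff // gt_eqF.
  move=> u; rewrite inE => /predU1P[->|us]; rewrite absvM.
    have := absv_triangle w (T b n - 1) 1; rewrite subrK absv1 => h4.
    move: h2; case: eqVneq => [-> _|wc0 h2]; first by rewrite mul0r.
    have wcp : 0 < w c by rewrite lt_def wc0 absv_ge0.
    have h5 : w (T b n) < (w c)^-1 by lra.
    by move: h5; rewrite -(ltr_pM2l wcp _ (w c)^-1) divff.
  have := h3 _ us; have uc := absv_ge0 u c; have uT := absv_ge0 u (T b n).
  rewrite -[X in _ < X]div1r ltr_pdivlMr; nra.
(* Here [w b] is 1: a power of b leaves [w c] unchanged, does not decrease the value at [v], and is
   small on [s]. *)
- have [n h1] : exists n, forall u, u \in s -> u b ^+ n < (1 + u c)^-1.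
    apply/ev_ex/ev_all => u us; apply: ev_powers_small; rewrite ?absv_ge0 ?sb //.
    by rewrite invr_gt0; have := absv_ge0 u c; lra.
  exists (c * b ^+ n).
    rewrite absvM absvX; apply: lt_le_trans vc _.
    by rewrite ler_peMr ?absv_ge0 // exprn_ege1 // ltW.
  move=> u; rewrite inE => /predU1P[->|us]; rewrite absvM absvX.
    by rewrite eq expr1n mulr1.
  have := h1 _ us; have uc := absv_ge0 u c.
  have uT : 0 <= u b ^+ n by rewrite exprn_ge0 ?absv_ge0.
  rewrite -[X in _ < X]div1r ltr_pdivlMr; nra.
Qed.

Lemma weak_approximation v (s : seq (absval R F)) c :
  1 < v c -> (forall u, u \in s -> u c = v c /\ u != v) ->
  forall e, 0 < e -> exists2 b, v (b - 1) < e & forall u, u \in s -> u b < e.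
Proof.
move=> c1 h e e0; have [||b vb sb] := @dominate v s; first by exists c.
  by move=> u /h[uc uv]; apply: (absv_separate uc _ uv); rewrite uc.
have [n [h1 h2]] : exists n, v (T b n - 1) < e /\ forall u, u \in s -> u (T b n) < e.
  apply/ev_ex/ev_and; first exact: ev_approx1.
  by apply: ev_all => u us; apply: ev_approx0 => //; exact: sb.
by exists (T b n).
Qed.

End WeakApproximation.

Local Notation pQC := (map_poly (ratr : rat -> algC)).

Definition conjs (a : algC) : seq algC := sval (closed_field_poly_normal (minCpoly a)).

(** * Conjugates and Galois invariants *)

Lemma map_in_alg (L : fieldExtType rat) (iota : {rmorphism L -> algC}) (P : {poly rat}) :
  map_poly iota (map_poly (in_alg L) P) = pQC P.
Proof.
rewrite -map_poly_comp; apply: eq_map_poly => q /=.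
by rewrite alg_num_field fmorph_rat.
Qed.

Lemma polyOver_rat (L : fieldExtType rat) (q : {poly L}) :
  (forall i, exists c : rat, q`_i = c%:A) -> exists P : {poly rat}, q = map_poly (in_alg L) P.
Proof.
move=> h; have [c cE] := choice h; exists (\poly_(i < size q) c i).
apply/polyP => i; rewrite coef_map coef_poly /=; case: ltnP => [lt|ge].
  by rewrite cE.
by rewrite nth_default // scale0r.
Qed.

Lemma map_surj (S : Type) (T : eqType) (f : S -> T) (r : seq T) :
  (forall y, y \in r -> exists z, f z = y) -> exists z : seq S, map f z = r.
Proof.
elim: r => [|y r IH] h; first by exists [::].
have [t <-] := h y (mem_head _ _).
have [|z <-] := IH; last by exists (t :: z).
by move=> x xr; apply: h; rewrite inE xr orbT.
Qed.

Section Conjugates.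
Implicit Types (a : algC) (P : {poly rat}).

Lemma minCpoly_prod a : minCpoly a = \prod_(y <- conjs a) ('X - y%:P).
Proof.
rewrite /conjs; case: closed_field_poly_normal => r /= {1}->.
by rewrite (monicP (minCpoly_monic a)) scale1r.
Qed.

Lemma mem_conjs a y : (y \in conjs a) = root (minCpoly a) y.
Proof. by rewrite minCpoly_prod root_prod_XsubC. Qed.

Lemma mem_conjs_self a : a \in conjs a.
Proof. by rewrite mem_conjs root_minCpoly. Qed.

(** Let d be the gcd of f and its derivative. If d vanishes at a, then f divides its derivative,
    which is excluded by degrees; otherwise f divides f / d, so d is constant. *)
Lemma uniq_conjs a : uniq (conjs a).
Proof.
rewrite -separable_prod_XsubC -minCpoly_prod.
have [f [fE fmon] fP] := minCpolyP a.
rewrite fE separable_map unlock.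
have f0 : f != 0 by rewrite monic_neq0.
have fa : root (pQC f) a by rewrite fP.
have f1 : (1 < size f)%N by have := size_minCpoly a; rewrite fE size_map_poly.
rewrite /coprimep; set d := gcdp _ _; have df : d %| f by exact: dvdp_gcdl.
have d0 : d != 0 by rewrite gcdp_eq0 negb_and f0.
have [da|da] := boolP (root (pQC d) a).
  have := dvdp_trans (_ : f %| d) (dvdp_gcdr f f^`()); rewrite -fP => /(_ da) ff'.
  have [f'0|f'0] := eqVneq f^`() 0.
    have := coef_deriv f (size f).-2; rewrite f'0 coef0 prednK; last by lia.
    rewrite -[f`__]/(lead_coef f) (monicP fmon) => /esym/eqP; rewrite pnatr_eq0; lia.
  by have := dvdp_leq f'0 ff'; rewrite leqNgt lt_size_deriv.
have : root (pQC (f %/ d)) a.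
  by move: fa; rewrite -{1}(divpK df) rmorphM rootM (negPf da) orbF.
rewrite fP => /dvdp_leq; rewrite divp_eq0 (negPf f0) (negPf d0) /= ltnNge dvdp_leq //= => /(_ isT).
rewrite size_divp // => h.
have : (0 < size d)%N by rewrite size_poly_gt0.
move: (dvdp_leq f0 df) h f1; move: (size d) (size f) => m n; lia.
Qed.

(** The field generated by all the conjugates splits the product of the minimal polynomials, and its
    generators are exactly the roots of that product. *)
Lemma exists_splitting_field (s : seq algC) :
  exists (L : splittingFieldType rat) (iota : {rmorphism L -> algC}),
    galois 1 {:L} /\ forall x y, x \in s -> y \in conjs x -> exists z, iota z = y.
Proof.
have [L0 [iota [s1 s1E s1full]]] := num_field_exists (flatten (map conjs s)).
have /choice[f fE] x : exists f : {poly rat}, pQC f = minCpoly x.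
  by have [f [fE _] _] := minCpolyP x; exists f.
have axL : SplittingField.axiom L0.
  exists (map_poly (in_alg L0) (\prod_(x <- s) f x)).
    by apply/polyOverP => i; rewrite coef_map /= memvZ ?mem1v.
  exists s1; last exact: s1full.
  have -> : map_poly (in_alg L0) (\prod_(x <- s) f x) = \prod_(z <- s1) ('X - z%:P).
    apply: (map_poly_inj iota); rewrite [RHS]rmorph_prod /=.
    under [RHS]eq_bigr do rewrite map_polyXsubC.
    rewrite -(big_map iota xpredT (fun z => 'X - z%:P)) s1E big_flatten big_map /=.
    by rewrite map_in_alg rmorph_prod /=; apply: eq_bigr => x _; rewrite fE minCpoly_prod.
  exact: eqpxx.
pose mix := FieldExt_isSplittingField.Build _ L0 axL.
pose L : splittingFieldType rat := HB.pack (FieldExt.sort L0) mix.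
exists L, iota; split.
  apply/and3P; split; [exact: sub1v| |exact: normalFieldf].
  apply/separableP => x _; apply: pcharf0_separable => p.
  by rewrite (pchar_lalg L) pchar_num.
move=> x y xs yx.
have : y \in flatten (map conjs s) by apply/flatten_mapP; exists x.
by rewrite -s1E => /mapP[z _ ->]; exists z.
Qed.

End Conjugates.

Section GaloisRational.
Variables (L : splittingFieldType rat) (iota : {rmorphism L -> algC}).
Hypothesis galL : galois 1 {:L}.

Lemma gal_fixed_rat x : (forall s, s \in 'Gal({:L} / 1)%g -> s x = x) ->
  exists q : rat, x = q%:A.
Proof.
move=> fix_x; apply/vlineP; rewrite -[1%VS]/(1%AS : {vspace L}).
rewrite -(galois_fixedField galL); apply/fixedFieldP; first exact: memvf.
by move=> s /fix_x.
Qed.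

Lemma gal_fixed_poly (p : {poly L}) :
  (forall s, s \in 'Gal({:L} / 1)%g -> map_poly s p = p) ->
  exists P : {poly rat}, map_poly iota p = pQC P.
Proof.
move=> fix_p; have [|P ->] := @polyOver_rat L p; last by exists P; rewrite map_in_alg.
by move=> i; apply: gal_fixed_rat => s /fix_p {2}<-; rewrite coef_map.
Qed.

Lemma gal_map_rat (s : gal_of {:L}) (P : {poly rat}) :
  map_poly s (map_poly (in_alg L) P) = map_poly (in_alg L) P.
Proof.
by rewrite -map_poly_comp; apply: eq_map_poly => q /=; rewrite linearZ /= rmorph1.
Qed.

End GaloisRational.

(** This is the characteristic polynomial of P(a) on Q(a). The Galois group permutes the conjugates
    of a, hence the factors, so the coefficients are fixed. *)
Lemma charpoly_rat (a : algC) (P : {poly rat}) :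
  exists Q : {poly rat}, \prod_(y <- conjs a) ('X - (pQC P).[y]%:P) = pQC Q.
Proof.
have [L [iota [galL ex]]] := exists_splitting_field [:: a].
have [z zE] := map_surj (fun y => ex a y (mem_head _ _)).
pose PL := map_poly (in_alg L) P.
have PLE t : iota PL.[t] = (pQC P).[iota t] by rewrite -horner_map map_in_alg.
have [s sG|Q QE] := @gal_fixed_poly L iota galL (\prod_(t <- z) ('X - PL.[t]%:P)).
  have [f [fE _] _] := minCpolyP a.
  have fz : map_poly (in_alg L) f = \prod_(t <- z) ('X - t%:P).
    apply: (map_poly_inj iota); rewrite [RHS]rmorph_prod /=.
    under [RHS]eq_bigr do rewrite map_polyXsubC.
    rewrite -(big_map iota xpredT (fun z => 'X - z%:P)) zE -minCpoly_prod fE.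
    exact: map_in_alg.
  have sz : perm_eq (map s z) z.
    apply: prod_XsubC_eq; rewrite -[RHS]fz -(gal_map_rat s) fz rmorph_prod /= big_map.
    by apply: eq_bigr => t _; rewrite map_polyXsubC.
  rewrite rmorph_prod /= -[RHS](perm_big _ sz) /= big_map; apply: eq_bigr => t _.
  rewrite map_polyXsubC /=; congr ('X - _%:P).
  by rewrite -horner_map /= gal_map_rat.
exists Q; rewrite -QE rmorph_prod /= -zE big_map; apply: eq_bigr => t _.
by rewrite map_polyXsubC /= PLE.
Qed.

(** * Places of a number field and local degrees *)

Section PolynomialPerturbation.
Variables (R : realType) (F : fieldType) (w : absval R F).

Lemma absv_coef_le (P : {poly F}) i : w P`_i <= \sum_(j < size P) w P`_j.
Proof.
have [lt|ge] := ltnP i (size P); last first.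
  by rewrite nth_default // absv0 sumr_ge0 // => j _; exact: absv_ge0.
rewrite (bigD1 (Ordinal lt)) //= lerDl sumr_ge0 // => j _; exact: absv_ge0.
Qed.

(** Continuity of the coefficients in the roots, for an arbitrary absolute value. It turns closeness
    of conjugates into closeness of characteristic polynomials. *)
Lemma prod_XsubC_continuous (T : eqType) (r : seq T) (d : T -> F) (eta : R) : 0 < eta ->
  exists2 e, 0 < e & forall c : T -> F, (forall y, y \in r -> w (c y - d y) < e) ->
    forall i, w (\prod_(y <- r) ('X - (c y)%:P) - \prod_(y <- r) ('X - (d y)%:P))`_i < eta.
Proof.
elim: r eta => [|y r IH] eta eta0.
  by exists 1 => // c _ i; rewrite !big_nil subrr coef0 absv0.
set P := \prod_(y <- r) ('X - (d y)%:P) in IH *.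
pose B := \sum_(j < size P) w P`_j.
have B0 : 0 <= B by apply: sumr_ge0 => j _; exact: absv_ge0.
have d0 := absv_ge0 w (d y).
(* The error is X(Q - P) - c_y (Q - P) - (c_y - d_y) P. The first two terms contribute at most (2 +
   w(d_y)) eta', the last at most f B; each budget is eta / 2. The summands 2 and 1 keep the
   denominators nonzero. *)
pose eta' := eta / (2 * (2 + w (d y))).
have eta'0 : 0 < eta' by rewrite divr_gt0 // mulr_gt0 //; lra.
have etaE : eta' * (2 + w (d y)) = eta / 2 by rewrite /eta'; field; rewrite gt_eqF //; lra.
have [e e0 he] := IH _ eta'0.
pose f := eta / (2 * (1 + B)).
have f0 : 0 < f by rewrite divr_gt0 // mulr_gt0 //; lra.
have fE : f * (1 + B) = eta / 2 by rewrite /f; field; rewrite gt_eqF //; lra.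
exists (Num.min e (Num.min 1 f)); first by rewrite !lt_min e0 f0 ltr01.
move=> c hc i; rewrite !big_cons -/P; set Q := \prod_(y <- r) ('X - (c y)%:P).
have hQ j : w (Q - P)`_j < eta'.
  by apply: he => z zr; have := hc z; rewrite inE zr orbT => /(_ isT); rewrite lt_min => /andP[].
have := hc y (mem_head _ _); rewrite !lt_min => /and3P[_ c1 cf].
have -> : ('X - (c y)%:P) * Q - ('X - (d y)%:P) * P =
   'X * (Q - P) - (c y)%:P * (Q - P) - (c y - d y)%:P * P by rewrite polyCB; ring.
rewrite 2!coefB coefXM !coefCM.
have cy : w (c y) <= 1 + w (d y).
  by have := absv_triangle w (c y - d y) (d y); rewrite subrK; lra.
have h1 : w (if i == 0%N then 0 else (Q - P)`_i.-1) < eta'.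
  by case: ifP; rewrite ?absv0.
have h2 : w (c y * (Q - P)`_i) <= (1 + w (d y)) * eta'.
  by rewrite absvM ler_pM ?absv_ge0 // ltW.
have h3 : w ((c y - d y) * P`_i) <= f * B.
  by rewrite absvM ler_pM ?absv_ge0 ?absv_coef_le // ltW.
apply: le_lt_trans (absvB _ _ _) _.
have h4 := absvB w (if i == 0%N then 0 else (Q - P)`_i.-1) (c y * (Q - P)`_i).
have := f0; nra.
Qed.

(* The coefficients of a polynomial are the product of its values at distinct points by the
   inverse of a Vandermonde matrix. *)
Lemma interpolation_bound (S : seq F) : uniq S ->
  exists2 M : R, 0 < M & forall (C : {poly F}) (delta : R), 0 <= delta -> (size C <= size S)%N ->
    (forall y, y \in S -> w C.[y] <= delta) -> forall i, w C`_i <= M * delta.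
Proof.
move=> uS; set s := size S.
pose a : 'rV[F]_s := \row_j S`_j.
pose V := Vandermonde s a.
have uV : V \in unitmx.
  rewrite unitmxE det_Vandermonde unitfE; apply/prodf_neq0 => i _.
  apply/prodf_neq0 => j ij; rewrite !mxE subr_eq0 nth_uniq //.
  by apply: contraTneq ij => ->; rewrite ltnn.
pose M := \sum_i \sum_j w (invmx V i j).
have M0 : 0 <= M by apply: sumr_ge0 => i _; apply: sumr_ge0 => j _; exact: absv_ge0.
exists (M + 1); first by lra.
move=> C delta delta0 sC hC i.
have [lt|ge] := ltnP i s; last first.
  by rewrite nth_default ?(leq_trans sC) // absv0 mulr_ge0 //; lra.
pose cv : 'rV[F]_s := \row_j C`_j.
pose ev : 'rV[F]_s := \row_j C.[S`_j].
have cvV : cv *m V = ev.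
  apply/rowP => j; rewrite !mxE (horner_coef_wide _ sC); apply: eq_bigr => k _.
  by rewrite !mxE.
have ci : C`_i = \sum_j ev 0 j * invmx V j (Ordinal lt).
  have : cv = ev *m invmx V by rewrite -cvV mulmxK.
  by move=> /rowP/(_ (Ordinal lt)); rewrite !mxE.
rewrite ci; apply: le_trans (absv_sum _ _ _ _) _.
apply: (@le_trans _ _ (\sum_j delta * \sum_k w (invmx V j k))).
  apply: ler_sum => j _; rewrite absvM ler_pM ?absv_ge0 // ?mxE ?hC ?mem_nth //.
  rewrite (bigD1 (Ordinal lt)) //= lerDl sumr_ge0 // => k _; exact: absv_ge0.
by rewrite -mulr_sumr -/M mulrC; nra.
Qed.

End PolynomialPerturbation.

Lemma minCpoly_conj a y : y \in conjs a -> minCpoly y = minCpoly a.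
Proof.
rewrite mem_conjs; have [f [fE fmon] fP] := minCpolyP a.
have [g [gE gmon] gP] := minCpolyP y; rewrite fE gP => gf.
rewrite gE; congr map_poly; apply/eqP; rewrite -eqp_monic //; apply/andP; split=> //.
have fa : root (pQC f) a by rewrite fP.
move: fa; rewrite -{1}(divpK gf) rmorphM rootM !fP => /orP[fh|//].
have f0 := monic_neq0 fmon; have g0 := monic_neq0 gmon.
have := dvdp_leq _ fh; rewrite divp_eq0 (negPf f0) (negPf g0) /= ltnNge dvdp_leq //=.
move=> /(_ isT); rewrite size_divp //; have := size_minCpoly y.
rewrite gE size_map_poly; have := dvdp_leq f0 gf.
by move: (size g) (size f) => m n; lia.
Qed.

Lemma conj_root_rat a y (P : {poly rat}) : y \in conjs a -> root (pQC P) y = root (pQC P) a.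
Proof.
move=> ya; have [f [fE _] fP] := minCpolyP a; have [g [gE _] gP] := minCpolyP y.
rewrite fP gP; congr (_ %| _); apply: (map_poly_inj (ratr : {rmorphism rat -> algC})).
by rewrite -gE -fE (minCpoly_conj ya).
Qed.

(** * The places above p as pull-backs along the conjugates of a generator *)

Section PlacesOverRationals.
Variables (R : realType) (K : fieldExtType rat) (theta : K).
Variable emb : {rmorphism K -> algC}.
Hypothesis gen : <<1; theta>>%VS = fullv.
Variables (p : option nat) (w : absval R algC).
Hypotheses (p_place : is_rat_place p) (hw : forall q, w (ratr q) = rat_abs R p q).

Let a := emb theta.
Implicit Types (P Q C H : {poly rat}) (v : absval R K).

(** All places above p agree on rationals, so one rational of large absolute value provides the
    common scaling element of [absv_separate]. *)
Lemma rat_abs_gt1 : exists c : rat, 1 < rat_abs R p c.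
Proof.
case: p p_place hw => [q|] /= hp hq; last by exists 2; rewrite rmorph_nat normr_nat; lra.
have q0 : (0 < q)%N := prime_gt0 hp.
exists (q%:R)^-1; rewrite -hq fmorphV absvV ?fmorph_eq0 ?pnatr_eq0 -?lt0n // hq.
have -> : numq q%:R = q%:Z by rewrite pmulrn numq_int.
have -> : denq q%:R = 1 by rewrite pmulrn denq_int.
rewrite pnatr_eq0 eqn0Ngt q0 /= logn1 expr0 mul1r invrK.
by rewrite logn_prime // eqxx expr1 ltr1n prime_gt1.
Qed.

(** Elements of [K] are handled as rational polynomials in [theta]: evaluating the same polynomial
    at a conjugate y stands for the embedding sending [theta] to y, which is never constructed. *)
Definition horner_gen P : K := (map_poly (in_alg K) P).[theta].
Local Notation evK := horner_gen.
Local Notation evC P y := (pQC P).[y].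

Lemma emb_evK P : emb (evK P) = evC P a.
Proof.
by rewrite /horner_gen -horner_map map_in_alg.
Qed.

Lemma evKB P Q : evK (P - Q) = evK P - evK Q.
Proof. by rewrite /horner_gen rmorphB hornerD hornerN. Qed.
Lemma evKD P Q : evK (P + Q) = evK P + evK Q.
Proof. by rewrite /horner_gen rmorphD hornerD. Qed.
Lemma evKM P Q : evK (P * Q) = evK P * evK Q.
Proof. by rewrite /horner_gen rmorphM hornerM. Qed.
Lemma evKC q : evK q%:P = q%:A.
Proof. by rewrite /horner_gen map_polyC hornerC. Qed.
Lemma evKX : evK 'X = theta.
Proof. by rewrite /horner_gen map_polyX hornerX. Qed.

Lemma evK_surj x : exists P, x = evK P.
Proof.
have : x \in <<1; theta>>%VS by rewrite gen memvf.
move=> /Fadjoin_polyP[q /polyOverP q1 ->].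
by have [i|P ->] := @polyOver_rat K q; [exact/vlineP/q1 | exists P].
Qed.

Lemma evK_eq0 P y : y \in conjs a -> (evC P y == 0) = (evK P == 0).
Proof. by move=> ya; rewrite -(fmorph_eq0 emb) emb_evK; exact: conj_root_rat. Qed.

Lemma evC_eq P Q y : y \in conjs a -> evK P = evK Q -> evC P y = evC Q y.
Proof.
move=> ya e; apply/eqP; rewrite -subr_eq0 -hornerN -hornerD -rmorphB evK_eq0 //.
by rewrite evKB e subrr.
Qed.

(* [v] is the pull-back of [w] along the embedding of [K] sending [theta] to [y]. *)
Definition pulls y v := forall P, v (evK P) = w (evC P y).

Lemma pulls_uniq y u v : pulls y u -> pulls y v -> u = v.
Proof.
by move=> hu hv; apply: absval_eq => x; have [P ->] := evK_surj x; rewrite hu hv.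
Qed.

Lemma pulls_ex y : y \in conjs a -> exists v, pulls y v.
Proof.
move=> ya; have [pol polE] := choice evK_surj.
pose f x := w (evC (pol x) y).
have fE P : f (evK P) = w (evC P y) by congr (w _); apply: evC_eq.
have f_ge0 x : 0 <= f x by exact: absv_ge0.
have f_eq0 x : (f x == 0) = (x == 0) by rewrite absv_eq0 evK_eq0 // -polE.
have fM x z : f (x * z) = f x * f z.
  by rewrite {1}(polE x) {1}(polE z) -evKM fE rmorphM hornerM absvM.
have fD x z : f (x + z) <= f x + f z.
  by rewrite {1}(polE x) {1}(polE z) -evKD fE rmorphD hornerD; exact: absv_triangle.
by exists (AbsVal f_ge0 f_eq0 fM fD).
Qed.

Definition above v := forall q : rat, v q%:A = rat_abs R p q.

Lemma pulls_above y v : pulls y v -> above v.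
Proof. by move=> h q; rewrite -evKC h map_polyC hornerC hw. Qed.

Lemma pull_fun : exists pull : algC -> absval R K, forall y, y \in conjs a -> pulls y (pull y).
Proof.
have [v0 _] := pulls_ex (mem_conjs_self a).
have h y : exists v, y \in conjs a -> pulls y v.
  have [ya|ya] := boolP (y \in conjs a); last by exists v0.
  by have [v hv] := pulls_ex ya; exists v.
by have [f hf] := choice h; exists f.
Qed.

Lemma conjs_gt0 b : (0 < size (conjs b))%N.
Proof. by have := mem_conjs_self b; case: conjs. Qed.

Lemma size_charpoly (T : eqType) (r : seq T) (c : T -> algC) Q :
  \prod_(y <- r) ('X - (c y)%:P) = pQC Q -> Q \is monic /\ size Q = (size r).+1.
Proof.
move=> e; rewrite -(map_monic (ratr : {rmorphism rat -> algC})) -e monic_prod_XsubC.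
by rewrite -(size_map_poly (ratr : {rmorphism rat -> algC})) -e size_prod_XsubC.
Qed.

(* Otherwise some [b] has [v b > 1] and small conjugates; then its characteristic polynomial is
   close to a power of ['X], which forces [v b <= 1]. *)
Lemma above_pulls v : above v -> exists2 y, y \in conjs a & pulls y v.
Proof.
move=> av; apply: contrapT => no.
have [pull hpull] := pull_fun.
have [c c1] := rat_abs_gt1.
pose s := map pull (conjs a).
have [||b vb sb] := @dominate R K v s; first by exists c%:A; rewrite av.
  move=> _ /mapP[y ya ->]; apply: (@absv_separate _ _ _ _ c%:A).
  - by rewrite av (pulls_above (hpull y ya)).
  - by rewrite (pulls_above (hpull y ya)).
  - by apply/eqP => e; apply: no; exists y => //; rewrite -e; exact: hpull.
pose n := size (conjs a).
(* With n lower coefficients each below 1 / (n + 1), the lower terms at a point of value greater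
   than 1 add up to less than the leading term. *)
have eta0 : 0 < n.+1%:R^-1 :> R by rewrite invr_gt0 ltr0n.
have [e e0 he] := prod_XsubC_continuous w (conjs a) (fun=> 0) eta0.
have [k [k0 hk]] : exists k, (0 < k)%N /\ forall u, u \in s -> u b ^+ k < e.
  apply/ev_ex/ev_and; first by exists 1%N.
  by apply: ev_all => u us; apply: ev_powers_small => //; [exact: absv_ge0|exact: sb].
have {}vb : 1 < v (b ^+ k) by rewrite absvX exprn_egt1 // -lt0n.
have [B BE] := evK_surj (b ^+ k); rewrite BE in vb.
have [Q QE] := charpoly_rat a B.
have [Qmon Qsize] := size_charpoly QE.
have Qsmall i : (i < n)%N -> rat_abs R p Q`_i < n.+1%:R^-1.
  move=> lt; have := he (fun y => evC B y) _ i.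
  rewrite QE big_const_seq count_predT iter_mulr_1 subr0 -/n coefB coefXn (ltn_eqF lt) subr0.
  rewrite coef_map hw; apply=> y ya; rewrite subr0 -(hpull y ya) -BE absvX.
  by apply: hk; exact: map_f.
set x := evK B in vb *.
have Qx : (map_poly (in_alg K) Q).[x] = 0.
  apply/eqP; rewrite -(fmorph_eq0 emb) -horner_map map_in_alg.
  rewrite -QE emb_evK horner_prod prodf_seq_eq0; apply/hasP.
  by exists a; rewrite ?mem_conjs_self // hornerXsubC subrr /=.
have n0 : (0 < n)%N by exact: conjs_gt0.
move: Qx; rewrite horner_coef size_map_poly Qsize -/n big_ord_recr /= coef_map /=.
have -> : Q`_n = 1 by rewrite -(monicP Qmon) lead_coefE Qsize.
rewrite scale1r mul1r => /eqP; rewrite addrC addr_eq0 => /eqP xn.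
have x0 : 0 < v x by lra.
have : v x ^+ n < v x ^+ n.
  rewrite -{1}absvX xn absvN; apply: le_lt_trans (absv_sum _ _ _ _) _.
  apply: (@le_lt_trans _ _ (\sum_(i < n) n.+1%:R^-1 * v x ^+ n)).
    apply: ler_sum => i _; rewrite absvM absvX coef_map /= av; apply: ler_pM.
    - by rewrite -hw; exact: absv_ge0.
    - by rewrite exprn_ge0 // ltW.
    - by apply: ltW; exact: Qsmall.
    - by rewrite ler_eXn2l // ltnW.
  rewrite sumr_const card_ord -mulrnAl gtr_pMl ?exprn_gt0 //.
  by rewrite -mulr_natr mulrC ltr_pdivrMr ?ltr0n // mul1r ltr_nat.
by rewrite ltxx.
Qed.

End PlacesOverRationals.

(** * Approximation at one place by polynomials of bounded degree *)

Section LocalDegree.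
Variables (R : realType) (K : fieldExtType rat) (theta : K).
Variable emb : {rmorphism K -> algC}.
Hypothesis gen : <<1; theta>>%VS = fullv.
Variables (p : option nat) (w : absval R algC).
Hypotheses (p_place : is_rat_place p) (hw : forall q, w (ratr q) = rat_abs R p q).
Variable v : absval R K.
Hypothesis hv : above p v.

Let a := emb theta.
Implicit Types (P Q C H : {poly rat}).
Local Notation evK := (horner_gen theta).
Local Notation evC P y := (pQC P).[y].

Definition local_conjs := [seq y <- conjs a | `[< pulls theta w y v >]].
Local Notation S := local_conjs.
Local Notation s := (size S).

Lemma mem_local_conjs y : y \in S -> pulls theta w y v.
Proof. by rewrite mem_filter => /andP[/asboolP]. Qed.

Lemma uniq_local_conjs : uniq S. Proof. by rewrite filter_uniq // uniq_conjs. Qed.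

Lemma local_conjs_gt0 : (0 < s)%N.
Proof.
have [y ya hy] := above_pulls emb gen p_place hw hv.
have : y \in S by rewrite mem_filter ya andbT; apply/asboolP.
by case: S.
Qed.

(* Take [b] close to 1 at [v] and to 0 at the other places above [p]: the characteristic
   polynomial of [b * theta] is close to ['X^(n - s)] times the product over [S]. *)
Lemma local_rat_poly (eta : R) : 0 < eta ->
  exists H, [/\ H \is monic, size H = s.+1 & v (evK H) < eta].
Proof.
move=> eta0.
have [y0 y0S] : exists y0, y0 \in S.
  by have := local_conjs_gt0; case: S => // y r _; exists y; rewrite mem_head.
have [pull hpull] := pull_fun emb gen w.
have [c c1] := rat_abs_gt1 p_place hw.
pose n := size (conjs a).
have sn : (s <= n)%N by rewrite size_filter count_size.
pose d y := if `[< pulls theta w y v >] then y else 0.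
pose fS := \prod_(y <- S) ('X - y%:P).
have dE : \prod_(y <- conjs a) ('X - (d y)%:P) = 'X^(n - s) * fS.
  rewrite (bigID (fun y => `[< pulls theta w y v >])) /= mulrC; congr (_ * _).
    rewrite (eq_bigr (fun=> 'X)); last by move=> y /negPf h; rewrite /d h subr0.
    rewrite big_const_seq iter_mulr_1 /n /S size_filter.
    by rewrite -(count_predC (fun y => `[< pulls theta w y v >]) (conjs a)) addKn.
  by rewrite /fS big_filter; apply: eq_bigr => y h; rewrite /d h.
pose W := \sum_(i < s.+1) w y0 ^+ i.
have W0 : 0 <= W by apply: sumr_ge0 => i _; rewrite exprn_ge0 // absv_ge0.
have eta'0 : 0 < eta / (1 + W) by rewrite divr_gt0 //; lra.
have [e e0 he] := prod_XsubC_continuous w (conjs a) d eta'0.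
pose Y := \sum_(y <- conjs a) w y.
have Y0 : 0 <= Y by apply: sumr_ge0 => i _; exact: absv_ge0.
have wY y : y \in conjs a -> w y <= Y.
  move=> ya; rewrite /Y (big_rem y) //= lerDl; apply: sumr_ge0 => i _; exact: absv_ge0.
(* The approximation of b is later multiplied by conjugates of [theta], all of size at most [Y]. *)
have e'0 : 0 < e / (1 + Y) by rewrite divr_gt0 //; lra.
pose others := [seq pull y | y <- conjs a & ~~ `[< pulls theta w y v >]].
have [|u|b vb ob] := @weak_approximation R K v others c%:A _ _ _ e'0.
- by rewrite hv.
- move=> /mapP[y]; rewrite mem_filter => /andP[ny ya] ->.
  rewrite hv (pulls_above hw (hpull y ya)); split=> //.
  by apply: contraNneq ny => e1; apply/asboolP; rewrite -e1; exact: hpull.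
have [B BE] := evK_surj gen b.
have [Q QE] := charpoly_rat a (B * 'X).
have [Qmon Qsize] := size_charpoly QE.
have Qclose i : w ((pQC Q)`_(i + (n - s)) - fS`_i) < eta / (1 + W).
  have := he (fun y => evC (B * 'X) y) _ (i + (n - s))%N.
  rewrite QE dE coefB coefXnM ltnNge leq_addl /= addnK; apply=> y ya.
  have wya := wY y ya; have wy0 := absv_ge0 w y.
  have eY : e / (1 + Y) * (1 + Y) = e by rewrite divfK // gt_eqF //; lra.
  rewrite rmorphM /= map_polyX hornerM hornerX /d; case: ifPn => [/asboolP hy|ny].
    have -> : evC B y * y - y = evC (B - 1) y * y.
      by rewrite rmorphB rmorph1 hornerD hornerN hornerC; ring.
    have b1 : b - 1 = evK (B - 1) by rewrite evKB BE -polyC1 evKC scale1r.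
    have := vb; rewrite b1 hy absvM; nra.
  have : pull y b < e / (1 + Y).
    by apply: ob; apply/mapP; exists y => //; rewrite mem_filter ny.
  by rewrite subr0 absvM BE hpull //; nra.
(* Since Q is close to 'X^(n - s) times [fS], discarding the n - s lowest coefficients leaves a
   rational monic polynomial close to [fS]. *)
pose H := drop_poly (n - s) Q.
have Hcoef i : H`_i = Q`_(i + (n - s)) by rewrite coef_drop_poly.
have Hsize : size H = s.+1 by rewrite size_drop_poly Qsize -/n; lia.
exists H; split=> //.
  rewrite monicE lead_coefE Hsize Hcoef /= subnKC // -(monicP Qmon) lead_coefE Qsize.
  by rewrite eqxx.
rewrite (mem_local_conjs y0S).
(* As [fS] vanishes at [y0], the value of H there is controlled by the coefficients of H - fS, and
   [y0] induces [v]. *)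
have fS0 : fS.[y0] = 0 by apply/rootP; rewrite root_prod_XsubC.
have sfS : size fS = s.+1 by rewrite size_prod_XsubC.
have -> : evC H y0 = evC H y0 - fS.[y0] by rewrite fS0 subr0.
rewrite !horner_coef size_map_poly Hsize sfS -sumrB.
apply: le_lt_trans (absv_sum _ _ _ _) _.
apply: (@le_lt_trans _ _ (\sum_(i < s.+1) eta / (1 + W) * w y0 ^+ i)).
  apply: ler_sum => i _; rewrite -mulrBl absvM absvX ler_wpM2r ?exprn_ge0 ?absv_ge0 //.
  by apply: ltW; have := Qclose i; rewrite !coef_map Hcoef.
rewrite -mulr_sumr -/W mulrAC ltr_pdivrMr; nra.
Qed.

(** [local_rat_poly] acts as an approximate relation of degree s for [theta]. In a Horner induction,
    multiplication by X creates a term of degree s, which is removed by subtracting a multiple of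
    that relation. *)
Lemma local_approx (x : K) (eta : R) : 0 < eta ->
  exists2 C : {poly rat}, (size C <= s)%N & v (x - evK C) < eta.
Proof.
have s0 := local_conjs_gt0.
have [P ->] := evK_surj gen x; elim/poly_ind: P eta => [|P c IH] eta eta0.
  by exists 0; rewrite ?size_poly0 // subrr absv0.
have t0 := absv_ge0 v theta.
have [|C sC hC] := IH (eta / (2 * (1 + v theta))).
  by rewrite divr_gt0 // mulr_gt0 //; lra.
(* This becomes the coefficient of degree s after multiplication by X. The polynomial H is taken so
   small at [v] that [l] times it costs at most half of [eta]. *)
set l := C`_s.-1.
have l0 : 0 <= rat_abs R p l by rewrite -hw absv_ge0.
have [|H [Hmon Hsize hH]] := @local_rat_poly (eta / (2 * (1 + rat_abs R p l))).
  by rewrite divr_gt0 // mulr_gt0 //; lra.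
exists (C * 'X + c%:P - l%:P * H).
  apply/leq_sizeP => j js; rewrite coefB coefD coefCM coefMX coefC.
  have j0 : (j == 0%N) = false by apply/eqP; lia.
  rewrite j0 addr0; have [ej|nj] := eqVneq j s.
    rewrite ej; have -> : H`_s = 1 by rewrite -(monicP Hmon) lead_coefE Hsize.
    by rewrite mulr1 subrr.
  have js' : (s < j)%N by rewrite ltn_neqAle eq_sym nj js.
  rewrite !nth_default ?mulr0 ?subrr ?Hsize //; apply: leq_trans sC _.
  by rewrite -ltnS prednK // (leq_ltn_trans _ js').
rewrite evKB !evKD !evKM !evKX !evKC.
have -> : evK P * theta + c%:A - (evK C * theta + c%:A - l%:A * evK H) =
   (evK P - evK C) * theta + l%:A * evK H by ring.
apply: le_lt_trans (absv_triangle _ _ _) _; rewrite !absvM hv.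
have h1 : v (evK P - evK C) * v theta <= eta / (2 * (1 + v theta)) * v theta.
  by rewrite ler_wpM2r // ltW.
have h2 : rat_abs R p l * v (evK H) <= rat_abs R p l * (eta / (2 * (1 + rat_abs R p l))).
  by rewrite ler_wpM2l // ltW.
have e1 : eta / (2 * (1 + v theta)) * (1 + v theta) = eta / 2.
  by field; rewrite gt_eqF //; lra.
have e2 : eta / (2 * (1 + rat_abs R p l)) * (1 + rat_abs R p l) = eta / 2.
  by field; rewrite gt_eqF //; lra.
have p1 : 0 < eta / (2 * (1 + v theta)) by rewrite divr_gt0 // mulr_gt0 //; lra.
have p2 : 0 < eta / (2 * (1 + rat_abs R p l)) by rewrite divr_gt0 // mulr_gt0 //; lra.
lra.
Qed.

(** A polynomial of degree less than s is determined by its s values on the local conjugates, and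
    these values all have the size of [evK C] at [v]. This yields both convergence and uniqueness of
    coordinates in the completion. *)
Lemma local_coef_bound : exists2 M : R, 0 < M &
  forall C : {poly rat}, (size C <= s)%N -> forall i, rat_abs R p C`_i <= M * v (evK C).
Proof.
have [M M0 hM] := interpolation_bound w uniq_local_conjs.
exists M => // C sC i; rewrite -hw -coef_map; apply: hM; first exact: absv_ge0.
  by rewrite size_map_poly.
by move=> y yS; rewrite (mem_local_conjs yS).
Qed.

End LocalDegree.

(** * Completions and the uniqueness of the local degree *)

Section CompletionFacts.
Local Open Scope quotient_scope.
Variables (R : realType) (F : fieldType) (v : absval R F).
Implicit Types u : cauchy_ring v.

Definition cauchy_of (f : nat -> F) (hf : cauchy_seq v f) : cauchy_ring v :=
  CauchySeq (introT (asboolP _) hf).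

Lemma pi_eqP u u' : \pi_(completion v) u = \pi_(completion v) u' <->
  null_seq v (fun n => u n - u' n).
Proof.
split=> [/eqP|h].
  by rewrite -Quotient.idealrBE => /asboolP.
by apply/eqP; rewrite -Quotient.idealrBE; apply/asboolP.
Qed.

Lemma cauchy_cst (x : F) : cauchy_seq v (fun=> x).
Proof. by move=> e e0; exists 0%N => m n _ _; rewrite subrr absv0. Qed.

Lemma cauchy_valD u u' n : (u + u') n = u n + u' n. Proof. by []. Qed.
Lemma cauchy_valM u u' n : (u * u') n = u n * u' n. Proof. by []. Qed.
Lemma cauchy_val_sum I (r : seq I) (P : pred I) (f : I -> cauchy_ring v) n :
  (\sum_(i <- r | P i) f i) n = \sum_(i <- r | P i) (f i n).
Proof. by elim/big_rec2: _ => // i y1 y2 _ <-; rewrite cauchy_valD. Qed.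

End CompletionFacts.

Section LocalDegreeUnique.
Local Open Scope quotient_scope.
Variables (R : realType) (K : fieldExtType rat) (v : absval R K).
Implicit Types x y : completion v.

Lemma Qp_in0 : Qp_in (0 : completion v).
Proof.
exists 0; last by rewrite raddf0.
by move=> n; exists 0; rewrite scale0r.
Qed.

Lemma Qp_in1 : Qp_in (1 : completion v).
Proof.
exists 1; last by rewrite rmorph1.
by move=> n; exists 1; rewrite scale1r.
Qed.

Lemma Qp_inD x y : Qp_in x -> Qp_in y -> Qp_in (x + y).
Proof.
move=> [u hu ->] [u' hu' ->]; exists (u + u'); last by rewrite rmorphD.
move=> n; have [q qE] := hu n; have [q' q'E] := hu' n; exists (q + q').
by rewrite cauchy_valD qE q'E scalerDl.
Qed.

Lemma Qp_inM x y : Qp_in x -> Qp_in y -> Qp_in (x * y).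
Proof.
move=> [u hu ->] [u' hu' ->]; exists (u * u'); last by rewrite rmorphM.
move=> n; have [q qE] := hu n; have [q' q'E] := hu' n; exists (q * q').
by rewrite cauchy_valM qE q'E -scalerAl mul1r scalerA.
Qed.

Lemma Qp_in_sum I (r : seq I) (P : pred I) (f : I -> completion v) :
  (forall i, P i -> Qp_in (f i)) -> Qp_in (\sum_(i <- r | P i) f i).
Proof. by move=> h; elim/big_ind: _ => //; [exact: Qp_in0|exact: Qp_inD]. Qed.

(** The base-change matrices are taken over the whole completion, where a rank argument is
    available. Their product is the identity because coordinates in [Qp_in] are unique and [Qp_in]
    is closed under sums and products. *)
Lemma local_degree_le d d' : has_local_degree v d -> has_local_degree v d' -> (d <= d')%N.
Proof.
move=> [e he] [e' he'].
have [A AE] := choice (fun i => he' (e i)).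
have [B BE] := choice (fun j => he (e' j)).
pose MA : 'M[completion v]_(d, d') := \matrix_(i, j) A i j.
pose MB : 'M[completion v]_(d', d) := \matrix_(j, i) B j i.
have AB : MA *m MB = 1%:M.
  apply/matrixP => i k; rewrite !mxE.
  have [c [_ cu]] := he (e i).
  have e1 : c = (fun k => (i == k)%:R).
    apply: cu; split.
      by move=> j; case: (i == j); [exact: Qp_in1|exact: Qp_in0].
    rewrite (bigD1 i) //= eqxx mul1r big1 ?addr0 // => j ji.
    by rewrite eq_sym (negPf ji) mul0r.
  have e2 : c = (fun k => \sum_j A i j * B j k).
    have [[A1 A2] _] := AE i.
    apply: cu; split.
      move=> j; apply: Qp_in_sum => l _; apply: Qp_inM => //.
      by have [[B1 _] _] := BE l.
    under eq_bigr do rewrite mulr_suml.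
    rewrite exchange_big /= {1}A2; apply: eq_bigr => j _.
    have [[_ B2] _] := BE j; rewrite {1}B2 mulr_sumr; apply: eq_bigr => l _.
    by rewrite mulrA.
  transitivity (\sum_j A i j * B j k); first by apply: eq_bigr => j _; rewrite !mxE.
  by move: e1; rewrite e2 => /(congr1 (fun f => f k)).
have := @mulmx1_min_rank _ d _ _ MA 1%:M MB; rewrite mul1mx => /(_ AB).
by move=> /leq_trans; apply; exact: rank_leq_col.
Qed.

Lemma local_degreeE d : has_local_degree v d -> local_degree v = d.
Proof.
move=> hd; rewrite /local_degree; case: xgetP => [d' _ hd'|/(_ d)//].
by apply/eqP; rewrite eqn_leq !local_degree_le.
Qed.

End LocalDegreeUnique.

(** * The local degree as the number of embeddings inducing the place *)

Section LocalDegreeValue.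
Local Open Scope quotient_scope.
Variables (R : realType) (K : fieldExtType rat) (theta : K).
Variable emb : {rmorphism K -> algC}.
Hypothesis gen : <<1; theta>>%VS = fullv.
Variables (p : option nat) (w : absval R algC).
Hypotheses (p_place : is_rat_place p) (hw : forall q, w (ratr q) = rat_abs R p q).
Variable v : absval R K.
Hypothesis hv : above p v.

Local Notation S := (local_conjs theta emb w v).
Local Notation s := (size S).
Local Notation evK := (horner_gen theta).

Lemma evK_poly (c : nat -> rat) n : evK (\poly_(i < n) c i) = \sum_(i < n) (c i)%:A * theta ^+ i.
Proof.
rewrite poly_def /horner_gen rmorph_sum /= horner_sum; apply: eq_bigr => i _.
by rewrite map_polyZ hornerZ map_polyXn hornerXn.
Qed.

(** The basis consists of the powers of [theta] below s. An element is a limit of polynomials of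
    degree less than s in [theta], whose coefficients converge by [local_coef_bound]. *)
Lemma has_local_degree_conjs : has_local_degree v s.
Proof.
pose e (i : 'I_s) : completion v := \pi_(completion v) (cauchy_of (cauchy_cst v (theta ^+ i))).
have piE (c : 'I_s -> cauchy_ring v) :
    \sum_(i < s) \pi_(completion v) (c i) * e i =
    \pi_(completion v) (\sum_(i < s) c i * cauchy_of (cauchy_cst v (theta ^+ i))).
  by rewrite rmorph_sum; apply: eq_bigr => i _; rewrite rmorphM.
have [M M0 hM] := local_coef_bound theta emb hw v.
exists e => x.
have [u ->] : exists u : cauchy_ring v, x = \pi_(completion v) u by exists (repr x); rewrite reprK.
have inv0 n : 0 < n.+1%:R^-1 :> R by rewrite invr_gt0 ltr0n.
have /choice[C hC] n : exists C : {poly rat},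
    (size C <= s)%N /\ v (u n - evK C) < n.+1%:R^-1.
  by have [C] := local_approx emb gen p_place hw hv (u n) (inv0 n); exists C.
have small (eta : R) : 0 < eta -> ev (fun n => n.+1%:R^-1 < eta).
  move=> eta0; exists (Num.bound eta^-1) => n le.
  rewrite -[eta]invrK ltf_pV2 ?posrE ?invr_gt0 ?ltr0n //.
  apply: lt_le_trans (archi_boundP _) _; first by rewrite invr_ge0 ltW.
  by rewrite ler_nat leqW.
have Ccauchy i : cauchy_seq v (fun n => ((C n)`_i)%:A).
  move=> eta eta0.
  have eM0 : 0 < eta / M / 3 by rewrite !divr_gt0.
  have [N hN] := small _ eM0.
  have [N' hN'] := @cauchy_ringP _ _ _ u _ eM0.
  exists (maxn N N') => m n; rewrite !geq_max => /andP[m1 m2] /andP[n1 n2].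
  rewrite -scalerBl -coefB hv.
  have sC : (size (C m - C n)%R <= s)%N.
    by apply: leq_trans (size_polyD _ _) _; rewrite size_polyN geq_max !(hC _).1.
  apply: le_lt_trans (hM _ sC i) _.
  have -> : eta = M * (eta / M / 3 + eta / M / 3 + eta / M / 3) by field; rewrite gt_eqF.
  rewrite ltr_pM2l // evKB.
  (* One third of the bound goes to the Cauchy sequence and one third to each of the two
     approximations. *)
  have -> : evK (C m) - evK (C n) = (u m - u n) - (u m - evK (C m)) + (u n - evK (C n)) by ring.
  apply: le_lt_trans (absv_triangle _ _ _) _.
  have := absvB v (u m - u n) (u m - evK (C m)).
  have := lt_trans (hC m).2 (hN _ m1); have := lt_trans (hC n).2 (hN _ n1).
  have := hN' _ _ m2 n2; move: (eta / M / 3) => t.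
  by move: (v _) (v _) (v _) (v _) => r1 r2 r3 r4; lra.
have xC : \pi_(completion v) u = \sum_(i < s) \pi_(completion v) (cauchy_of (Ccauchy i)) * e i.
  rewrite piE; apply/pi_eqP => eta /small[N hN]; exists N => n /hN.
  apply: lt_trans; apply: le_lt_trans (hC n).2.
  rewrite cauchy_val_sum le_eqVlt; apply/orP; left; apply/eqP; congr (v (_ - _)).
  have CE : C n = \poly_(i < s) (C n)`_i.
    apply/polyP => i; rewrite coef_poly; case: ltnP => // si.
    by rewrite nth_default // (leq_trans (hC n).1).
  by rewrite [in RHS]CE evK_poly; apply: eq_bigr => i _; rewrite cauchy_valM.
exists (fun i : 'I_s => \pi_(completion v) (cauchy_of (Ccauchy i))); split.
  by split=> // i; exists (cauchy_of (Ccauchy i)) => // n; exists (C n)`_i.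
move=> c' [hc' xE]; apply/funext => i.
have /choice[u' hu'] (j : 'I_s) : exists u' : cauchy_ring v,
    (forall n, exists q : rat, u' n = q%:A) /\ c' j = \pi_(completion v) u'.
  by have [u' h1 h2] := hc' j; exists u'.
have /choice[q qE] (jn : 'I_s * nat) : exists q : rat, u' jn.1 jn.2 = q%:A.
  exact: (hu' jn.1).1.
(* The coordinates are extended by 0 beyond s so that they can be used in [\poly]. *)
pose q' (j n : nat) : rat := oapp (fun o : 'I_s => q (o, n)) 0 (insub j).
have q'E (j : 'I_s) n : q' j n = q (j, n) by rewrite /q' valK.
(* The difference of two expansions of the same element tends to 0 at [v], so its coefficients do by
   [local_coef_bound]. *)
pose D n := \poly_(j < s) ((C n)`_j - q' j n).
have D0 eta : 0 < eta -> ev (fun n => v (evK (D n)) < eta).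
  have : \pi_(completion v) (\sum_(j < s) cauchy_of (Ccauchy j) *
            cauchy_of (cauchy_cst v (theta ^+ j))) =
         \pi_(completion v) (\sum_(j < s) u' j * cauchy_of (cauchy_cst v (theta ^+ j))).
    rewrite -!piE -xC xE; apply: eq_bigr => j _; by rewrite (hu' j).2.
  move=> /pi_eqP h eta0; apply: ev_imp (h _ eta0) => n.
  rewrite !cauchy_val_sum evK_poly -sumrB.
  rewrite [X in v X < _ -> _](_ : _ = \sum_(j < s) ((C n)`_j - q' j n)%:A * theta ^+ j) //.
  apply: eq_bigr => j _; rewrite !cauchy_valM /= -mulrBl q'E scalerBl.
  by rewrite -[u' j n]/(u' (j, n).1 (j, n).2) qE.
rewrite (hu' i).2; apply/pi_eqP => eta eta0.
have eM0 : 0 < eta / M by rewrite divr_gt0.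
apply: ev_imp (D0 _ eM0) => n hn /=.
rewrite -[u' i n]/(u' (i, n).1 (i, n).2) qE /= -scalerBl hv.
have sD : (size (D n) <= s)%N by exact: size_poly.
have := hM _ sD i; rewrite coef_poly ltn_ord q'E => /le_lt_trans; apply.
by rewrite mulrC -ltr_pdivlMr.
Qed.

Lemma local_degree_conjs : local_degree v = s.
Proof. exact/local_degreeE/has_local_degree_conjs. Qed.

End LocalDegreeValue.

(** * Mahler measure as a product over conjugates *)

Section LocalMahler.
Variables (R : realType) (w : absval R algC).

Definition local_mahler (a : algC) : R := \prod_(y <- conjs a) Num.max 1 (w y).

Lemma max1_ge1 (t : R) : 1 <= Num.max 1 t. Proof. by rewrite le_max lexx. Qed.
Lemma max1_ge0 (t : R) : 0 <= Num.max 1 t. Proof. by rewrite le_max ler01. Qed.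

Lemma prod_max1_ge1 I (r : seq I) (f : I -> R) : 1 <= \prod_(i <- r) Num.max 1 (f i).
Proof.
apply: (big_ind (fun z : R => 1 <= z)) => // [x y hx hy|i _]; last exact: max1_ge1.
by rewrite -[1]mulr1 ler_pM.
Qed.

End LocalMahler.

Section MahlerFormula.
Variable R : realType.

Record rational_extension (W : option nat -> absval R algC) : Prop := RatExt {
  rat_ext_rat : forall p, is_rat_place p -> forall q, W p (ratr q) = rat_abs R p q;
  rat_ext_ultra : forall p, prime p -> ultrametric (W (Some p))
}.

Lemma rational_extension_ex : exists W, rational_extension W.
Proof.
have h p : exists w : absval R algC, is_rat_place p ->
    (forall q, w (ratr q) = rat_abs R p q) /\ (p != None -> ultrametric w).
  case: p => [p|]; last first.
    by exists (arch_absval R) => _; split=> // q; exact: arch_fun_rat.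
  have [p_pr|p_pr] := boolP (prime p); last by exists (arch_absval R); rewrite /= (negPf p_pr).
  by have [w h1 h2] := exists_padic_absval R p_pr; exists w.
have [W hW] := choice h; exists W; split=> p hp; first by have [] := hW p hp.
by have [_] := hW (Some p) hp; apply.
Qed.

Lemma rat_abs_nat_le1 p n : prime p -> rat_abs R (Some p) n%:R <= 1.
Proof.
move=> p_pr; rewrite /rat_abs; case: eqVneq => // n0.
have -> : denq n%:R = 1 by rewrite pmulrn denq_int.
rewrite logn1 expr0 mul1r invf_le1 ?exprn_gt0 ?ltr0n ?prime_gt0 //.
by rewrite exprn_ege1 // ler1n prime_gt0.
Qed.

Lemma rat_abs_prime p q : prime p -> prime q -> rat_abs R (Some p) q%:R =
  if p == q then p%:R^-1 else 1.
Proof.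
move=> p_pr q_pr; rewrite /rat_abs pnatr_eq0 eqn0Ngt prime_gt0 //=.
have -> : denq q%:R = 1 by rewrite pmulrn denq_int.
have -> : numq q%:R = q%:Z by rewrite pmulrn numq_int.
rewrite logn1 expr0 mul1r /= logn_prime //.
by case: eqP; rewrite ?expr1 ?expr0 ?invr1.
Qed.

(** A prime p' is small only at p', and 2 exceeds 1 only at the archimedean place. *)
Lemma rat_abs_inj p p' : is_rat_place p -> is_rat_place p' ->
  (forall q, rat_abs R p q = rat_abs R p' q) -> p = p'.
Proof.
have arch n : rat_abs R None n%:R = n%:R by rewrite /= rmorph_nat normr_nat.
case: p p' => [p|] [p'|] hp hp' e //.
- have := e p'%:R; rewrite !rat_abs_prime // eqxx.
  case: eqP => [->//|_] /esym/eqP; rewrite invr_eq1 -[1]/1%:R eqr_nat.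
  by move=> /eqP p1; move: hp'; rewrite p1.
- by have := rat_abs_nat_le1 2 hp; rewrite e arch lern1.
- by have := rat_abs_nat_le1 2 hp'; rewrite -e arch lern1.
Qed.

Lemma ultra_sum (F : fieldType) (w : absval R F) (M : R) I (r : seq I) (P : pred I) (f : I -> F) :
  ultrametric w -> 0 <= M -> (forall i, P i -> w (f i) <= M) ->
  w (\sum_(i <- r | P i) f i) <= M.
Proof.
move=> uw M0 h; elim/big_ind: _ => // [|x y hx hy]; first by rewrite absv0.
by apply: le_trans (uw x y) _; rewrite ge_max hx.
Qed.

Variable W : option nat -> absval R algC.
Hypothesis hW : rational_extension W.

(** A prime beyond all denominators of the monic minimal polynomial makes its coefficients integral;
    a root of value greater than 1 would then have a leading term that the others cannot cancel. *)
Lemma conjs_almost_integral a : exists B : nat, forall p, prime p -> (B < p)%N ->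
  forall y, y \in conjs a -> W (Some p) y <= 1.
Proof.
have [f [fE fmon] _] := minCpolyP a.
exists (\sum_(i < size f) `|denq f`_i|)%N => p p_pr Bp y.
rewrite mem_conjs fE => /rootP.
have f1 i : rat_abs R (Some p) f`_i <= 1.
  have [lt|ge] := ltnP i (size f); last by rewrite nth_default.
  rewrite /rat_abs; case: eqP => // _.
  have -> : logn p `|denq f`_i| = 0%N.
    apply/eqP; rewrite -leqn0 leqNgt logn_gt0; apply/negP.
    rewrite mem_primes => /and3P[_ d0 /(dvdn_leq d0)].
    apply/negP; rewrite -ltnNge; apply: leq_ltn_trans Bp.
    by rewrite (bigD1 (Ordinal lt)) //= leq_addr.
  rewrite expr0 mul1r invf_le1 ?exprn_gt0 ?ltr0n ?prime_gt0 //.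
  by rewrite exprn_ege1 // ler1n prime_gt0.
rewrite horner_coef size_map_poly.
have f0 : (0 < size f)%N by rewrite size_poly_gt0 monic_neq0.
rewrite -(prednK f0) big_ord_recr /= coef_map /=; set n := (size f).-1.
have -> : f`_n = 1 by rewrite -(monicP fmon).
rewrite rmorph1 mul1r => /eqP; rewrite addrC addr_eq0 => /eqP yn.
rewrite leNgt; apply/negP => wy.
have w0 : 0 < W (Some p) y by lra.
have n0 : (0 < n)%N.
  by have := size_minCpoly a; rewrite fE size_map_poly /n; case: (size f) => [|[]].
have : W (Some p) y ^+ n <= W (Some p) y ^+ n.-1.
  rewrite -absvX yn absvN; apply: ultra_sum; first exact: rat_ext_ultra.
    by rewrite exprn_ge0 // ltW.
  move=> i _; rewrite absvM absvX coef_map /= (rat_ext_rat hW) //.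
  rewrite -[leRHS]mul1r; apply: ler_pM => //.
  - by rewrite -(rat_ext_rat hW) // absv_ge0.
  - by rewrite exprn_ge0 // ltW.
  - by rewrite ler_eXn2l // -ltnS prednK.
by rewrite ler_eXn2l // leqNgt prednK // leqnn.
Qed.

Definition bad_places_in (P : seq (option nat)) a :=
  forall p, is_rat_place p -> p \notin P -> forall y, y \in conjs a -> W p y <= 1.

(** Raising to the degree of the field clears the denominator in the exponent of
    [normalized_abs]. *)
Lemma max1_powR (t : R) (d n : nat) : 0 <= t -> (0 < n)%N ->
  Num.max 1 (t `^ (d%:R / n%:R)) ^+ n = Num.max 1 t ^+ d.
Proof.
move=> t0 n0; have r0 : 0 <= d%:R / n%:R :> R by rewrite divr_ge0.
have [t1|t1] := leP t 1.
  rewrite (max_idPl _) ?expr1n //.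
  have := ge0_ler_powR r0 t0 ler01 t1; by rewrite powR1.
have h : 1 <= t `^ (d%:R / n%:R).
  have := ge0_ler_powR r0 ler01 t0 (ltW t1); by rewrite powR1.
rewrite (max_idPr h) -powR_mulrn ?powR_ge0 // -powRrM divfK ?powR_mulrn //.
by rewrite pnatr_eq0 -lt0n.
Qed.

Lemma flatten_uniq (T U : eqType) (f : T -> seq U) (r : seq T) : uniq r ->
  (forall x, x \in r -> uniq (f x)) ->
  (forall x y z, x \in r -> y \in r -> z \in f x -> z \in f y -> x = y) ->
  uniq (flatten (map f r)).
Proof.
elim: r => //= x r IH /andP[xr ur] uf inj; rewrite cat_uniq uf ?mem_head //=.
rewrite IH //; last 2 first.
- by move=> y yr; apply: uf; rewrite inE yr orbT.
- by move=> y y' z yr yr'; apply: inj; rewrite inE ?yr ?yr' orbT.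
rewrite andbT; apply/hasPn => z /flatten_mapP[y yr zy]; apply/negP => zx.
by move: xr; rewrite (inj x y z) ?yr ?mem_head // inE yr orbT.
Qed.

(** A place v enters M(a) with exponent its local degree, which is also the number of conjugates
    inducing v. Grouping the conjugates by the place they induce matches the two products. *)
Lemma mahlerE (P : seq (option nat)) a : uniq P -> all is_rat_place P ->
  bad_places_in P a -> mahler_measure R a = \prod_(p <- P) local_mahler (W p) a.
Proof.
move=> uP /allP placeP badP.
rewrite /mahler_measure /weil_height /weil_height_in.
set K := Qadj a; set x := Qadj_gen a; set emb := Qadj_embed a.
have gen : <<1; x>>%VS = fullv by exact: Qadj_full.
have embx : emb x = a by exact: Qadj_genE.
have pullx p y v : pulls x (W p) y v -> v x = W p y.
  by move=> h; rewrite -{1}(evKX x) h map_polyX hornerX.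
have h p := pull_fun emb gen (W p).
have {h} [pull] := choice h; rewrite embx => hpull.
(* The places above the members of [P]; duplicates are removed since several conjugates may induce
   one place. Outside this list every factor is 1. *)
pose T := flatten [seq undup (map (pull p) (conjs a)) | p <- P].
have pull_above p y : p \in P -> y \in conjs a -> above p (pull p y).
  by move=> pP ya; apply: (pulls_above _ (hpull p y ya)); exact/(rat_ext_rat hW)/placeP.
have memT v : v \in T -> exists p y, [/\ p \in P, y \in conjs a & v = pull p y].
  move=> /flatten_mapP[p pP]; rewrite mem_undup => /mapP[y ya ->].
  by exists p, y.
have uT : uniq T.
  apply: flatten_uniq => // [p _|p p' v pP pP']; first exact: undup_uniq.
  rewrite !mem_undup => /mapP[y ya ->] /mapP[y' ya' e].
  apply: rat_abs_inj; [exact: placeP|exact: placeP|] => q.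
  by rewrite -(pull_above _ _ pP ya) e (pull_above _ _ pP' ya').
rewrite (@fsbigE _ _ _ _ _ T) //; last 2 first.
- move=> v /= /memT[p [y [pP ya ->]]]; exists p; first exact: placeP.
  exact: pull_above.
- move=> v [p pp hv] vT; have [y] := above_pulls emb gen pp (rat_ext_rat hW pp) hv.
  rewrite embx => ya hy; apply/max_idPl.
  have vE : v = pull p y by apply: (pulls_uniq gen hy); exact: hpull.
  have pP : p \notin P.
    apply: contra vT => pP; apply/flatten_mapP; exists p => //.
    by rewrite mem_undup vE map_f.
  rewrite /normalized_abs; set r := _ / _.
  have r0 : 0 <= r by rewrite divr_ge0.
  have vx : v x <= 1 by rewrite (pullx _ _ _ hy); exact: badP ya.
  by have := ge0_ler_powR r0 (absv_ge0 v x) ler01 vx; rewrite powR1.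
rewrite -prodrXl.
rewrite [LHS](_ : _ = \prod_(v <- T) Num.max 1 (v x) ^+ local_degree v); last first.
  rewrite big_mkcond; apply: eq_big_seq => v vT.
  rewrite ifT; last first.
    rewrite inE; have [p [y [pP ya ->]]] := memT v vT; exists p; first exact: placeP.
    exact: pull_above.
  by rewrite /normalized_abs max1_powR ?absv_ge0 // adim_gt0.
rewrite /T big_flatten big_map; apply: eq_big_seq => p pP.
have pp := placeP p pP.
rewrite /local_mahler [RHS](eq_big_seq (fun y => Num.max 1 (pull p y x))); last first.
  by move=> y ya; rewrite (pullx _ _ _ (hpull p y ya)).
rewrite -(big_map (pull p) xpredT (fun v : absval R K => Num.max 1 (v x))).
(* Equal factors are collected: the multiplicity of v is the number of conjugates inducing it. *)
rewrite -[RHS]big_undup_iterop_count; apply: eq_big_seq => v.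
rewrite mem_undup => /mapP[y ya vE].
have hv : above p v by rewrite vE; exact: pull_above.
rewrite (local_degree_conjs emb gen pp (rat_ext_rat hW pp) hv) size_filter embx.
rewrite count_map; congr (_ ^+ _); apply: eq_in_count => z za /=.
apply/asboolP/eqP => [hz|<-]; last exact: hpull.
by apply: (pulls_uniq gen _ hz); exact: hpull.
Qed.

Lemma bad_places_ex a : exists B : nat, forall P : seq (option nat),
  None \in P -> (forall p, prime p -> (p <= B)%N -> Some p \in P) -> bad_places_in P a.
Proof.
have [B hB] := conjs_almost_integral a; exists B => P PN hP [p|] /= hp; last by rewrite PN.
move=> pP; apply: hB => //; rewrite ltnNge; apply: contra pP; exact: hP.
Qed.

Lemma mahler_le a b : (forall p, is_rat_place p -> local_mahler (W p) a <= local_mahler (W p) b) ->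
  mahler_measure R a <= mahler_measure R b.
Proof.
move=> le_ab; have [A hA] := bad_places_ex a; have [B hB] := bad_places_ex b.
(* One finite list that contains the nontrivial places of both a and b, so that the two products are
   compared factor by factor. *)
pose P := None :: [seq Some p | p <- iota 0 (A + B).+1 & prime p].
have uP : uniq P.
  rewrite cons_uniq; apply/andP; split; first by apply/mapP => -[].
  by rewrite map_inj_uniq ?filter_uniq ?iota_uniq // => ? ? [].
have placeP : all is_rat_place P.
  by apply/allP => p; rewrite inE => /predU1P[->//|/mapP[q]]; rewrite mem_filter => /andP[qp _] ->.
have PN : None \in P by rewrite mem_head.
have hP p : prime p -> (p <= A + B)%N -> Some p \in P.
  move=> pp le; rewrite in_cons; apply/orP; right; apply/mapP; exists p => //.
  by rewrite mem_filter pp mem_iota add0n ltnS.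
rewrite !(@mahlerE P) //; last 2 first.
- by apply: hB => // p pp le; apply: hP => //; apply: leq_trans le (leq_addl _ _).
- by apply: hA => // p pp le; apply: hP => //; apply: leq_trans le (leq_addr _ _).
rewrite big_seq [leRHS]big_seq; apply: ler_prod => p pP; rewrite le_ab ?(allP placeP) // andbT.
by apply: prodr_ge0 => y _; exact: max1_ge0.
Qed.

End MahlerFormula.

(** * Norms to a normal subfield *)

Lemma uniq_map_inj (T U : eqType) (f : T -> U) (r : seq T) :
  uniq (map f r) -> {in r &, injective f}.
Proof.
elim: r => //= z r IH /andP[zr /IH inj] x y; rewrite !inE.
move=> /predU1P[->|xr] /predU1P[->|yr] e //; last exact: inj.
- by move: zr; rewrite e map_f.
- by move: zr; rewrite -e map_f.
Qed.

Section OrbitProducts.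
Variable L : splittingFieldType rat.
Implicit Types (K : {subfield L}) (a : L).
Local Open Scope group_scope.
Local Open Scope ring_scope.
Local Notation "''Gal' ( A / B )" := (galoisG A B)%g.

Lemma gal_stab K a (x : gal_of {:L}) : x \in 'Gal({:L} / K) -> x a = a ->
  x \in 'Gal({:L} / <<K; a>>).
Proof.
move=> xK xa; rewrite gal_kHom ?subvf //; apply/kAHomP => _ /Fadjoin_polyP[q Kq ->].
by rewrite -horner_map /= (fixedPoly_gal (subvf K) xK) // xa.
Qed.

(** The list [r] picks one automorphism for each element of the orbit. The automorphisms with the
    same effect on a as x form a translate of the stabiliser, which explains the exponent. *)
Lemma orbit_prod K a (T : comPzSemiRingType) (g : L -> T) (r : seq (gal_of {:L})) :
  r \subset 'Gal({:L} / K) -> uniq [seq x a | x : gal_of {:L} <- r] ->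
  minPoly K a = \prod_(b <- [seq x a | x : gal_of {:L} <- r]) ('X - b%:P) ->
  \prod_(x in 'Gal({:L} / K)) g (x a) = (\prod_(x <- r) g (x a)) ^+ #|'Gal({:L} / <<K; a>>)|.
Proof.
move=> /fintype.subsetP rK ur mE.
have exr (s : gal_of {:L}) : exists x, s \in 'Gal({:L} / K) -> x \in r /\ x a = s a.
  have [sK|] := boolP (s \in 'Gal({:L} / K)); last by exists 1%g.
  have := root_minPoly_gal (subvf K) sK (memvf a).
  by rewrite mE root_prod_XsubC => /mapP[x xr e]; exists x.
have [rho hrho] := choice exr.
rewrite (partition_big rho (mem r)) /=; last by move=> s /hrho[].
have ur' : uniq r by apply: map_uniq ur.
rewrite (big_uniq _ ur') /= -prodrXl; apply: eq_bigr => x xr.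
rewrite (eq_bigr (fun=> g (x a))); last by move=> s /andP[sK /eqP <-]; have [_ ->] := hrho s sK.
rewrite prodr_const; congr (_ ^+ _).
rewrite -[RHS](card_imset _ (mulIg x)); apply: eq_card => s; rewrite [LHS]unfold_in.
apply/andP/imsetP => [[sK /eqP sx]|[h hK ->]].
  exists (s * x^-1)%g; last by rewrite mulgKV.
  apply: gal_stab; first by rewrite groupM // groupV rK.
  by rewrite galM ?memvf // -(hrho s sK).2 sx -galM ?memvf // mulgV gal_id.
have hK' : h \in 'Gal({:L} / K) by apply: fintype.subsetP hK; apply: galS; exact: subv_adjoin.
have hx : (h * x)%g \in 'Gal({:L} / K) by rewrite groupM // rK.
split=> //; have [h1 h2] := hrho _ hx.
have ha : h a = a by apply: (fixed_gal (subvf _) hK); exact: memv_adjoin.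
apply/eqP; move: h2; rewrite galM ?memvf // ha => e.
exact: uniq_map_inj ur _ _ h1 xr e.
Qed.

(** [orbit_prod] for the constant function 2, with exponents compared. *)
Lemma orbit_card K a (r : seq (gal_of {:L})) :
  r \subset 'Gal({:L} / K) -> uniq [seq x a | x : gal_of {:L} <- r] ->
  minPoly K a = \prod_(b <- [seq x a | x : gal_of {:L} <- r]) ('X - b%:P) ->
  #|'Gal({:L} / K)| = (size r * #|'Gal({:L} / <<K; a>>)|)%N.
Proof.
move=> rK ur mE; have := orbit_prod (fun=> 2 : rat) rK ur mE.
rewrite prodr_const big_const_seq count_predT iter_mulr_1 -exprM.
by apply: ieexprIn.
Qed.

Variable iota : {rmorphism L -> algC}.

Lemma map_minPoly_iota x : map_poly iota (minPoly 1 x) = minCpoly (iota x).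
Proof.
have [f [fE fmon] fP] := minCpolyP (iota x).
have /polyOverP m1 := minPolyOver 1 x.
have [i|P PE] := @polyOver_rat L (minPoly 1 x); first exact/vlineP/m1.
rewrite PE map_in_alg fE; congr map_poly.
have Pmon : P \is monic by rewrite -(map_monic (in_alg L)) -PE monic_minPoly.
apply/eqP; rewrite -eqp_monic //; apply/andP; split; last first.
  by rewrite -fP -(map_in_alg iota) -PE fmorph_root root_minPoly.
rewrite -(dvdp_map (in_alg L)) -PE minPoly_dvdp //.
  by apply/polyOverP => i; rewrite coef_map /= memvZ ?mem1v.
by rewrite -(fmorph_root iota) map_in_alg -fE root_minCpoly.
Qed.

Lemma conjs_iota x (r : seq (gal_of {:L})) :
  minPoly 1 x = \prod_(b <- [seq s x | s : gal_of {:L} <- r]) ('X - b%:P) ->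
  perm_eq [seq iota (s x) | s : gal_of {:L} <- r] (conjs (iota x)).
Proof.
move=> mE; apply: prod_XsubC_eq; rewrite -minCpoly_prod -map_minPoly_iota mE rmorph_prod /=.
by rewrite !big_map; apply: eq_bigr => s _; rewrite map_polyXsubC.
Qed.

Hypothesis galL : galois 1 {:L}.
Variable R : realType.
Variable w : absval R algC.

(** Products over the whole Galois group make local Mahler measures of elements of different degrees
    comparable. *)
Lemma gal_prod_conjs x : \prod_(s in 'Gal({:L} / 1)) Num.max 1 (w (iota (s x))) =
  local_mahler w (iota x) ^+ #|'Gal({:L} / <<1; x>>)|.
Proof.
have [r [rG ur mE]] := galois_factors (sub1v _) galL x (memvf x).
rewrite (orbit_prod (K := 1%AS) (fun y => Num.max 1 (w (iota y))) rG ur mE).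
congr (_ ^+ _); rewrite /local_mahler -(perm_big _ (conjs_iota mE)) /= big_map.
by apply: eq_bigr.
Qed.

Section NormalSubfield.
Variable K : {subfield L}.
Hypothesis nK : normalField 1 K.
Variables (a : L) (r : seq (gal_of {:L})).
Hypotheses (rK : r \subset 'Gal({:L} / K)) (ur : uniq [seq x a | x : gal_of {:L} <- r]).
Hypothesis mE : minPoly K a = \prod_(b <- [seq x a | x : gal_of {:L} <- r]) ('X - b%:P).

Definition orbit_norm : L := \prod_(x <- r) x a.

(** Up to sign the orbit product is the constant term of the minimal polynomial over [K], hence lies
    in [K] and depends on a only through that polynomial. *)
Lemma orbit_normE : orbit_norm = (-1) ^+ size r * (minPoly K a).[0].
Proof.
rewrite mE horner_prod /orbit_norm big_map.
rewrite [X in _ * X](eq_bigr (fun x : gal_of {:L} => -1 * x a)); last first.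
  by move=> x _; rewrite hornerXsubC sub0r mulN1r.
rewrite big_split /= big_const_seq count_predT iter_mulr_1 mulrA -exprMn.
by rewrite mulrNN mulr1 expr1n mul1r.
Qed.

Lemma orbit_norm_mem : orbit_norm \in K.
Proof.
rewrite orbit_normE rpredM //; first by rewrite rpredX // rpredN mem1v.
by rewrite horner_coef0; apply/polyOverP/minPolyOver.
Qed.

(** By normality t preserves [K], so it maps the minimal polynomial of a over [K] to a polynomial
    over [K] of the same degree vanishing at a, that is, to itself. *)
Lemma orbit_norm_fix (t : gal_of {:L}) :
  t \in 'Gal({:L} / 1) -> t a = a -> t orbit_norm = orbit_norm.
Proof.
move=> tG ta.
have tm : map_poly t (minPoly K a) = minPoly K a.
  apply/eqP; rewrite -eqp_monic ?map_monic ?monic_minPoly // eqp_sym -dvdp_size_eqp.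
    by rewrite size_map_poly.
  apply: minPoly_dvdp; last by rewrite -[a in root _ a]ta fmorph_root root_minPoly.
  have : kAut 1 K t.
    by apply: (@normalField_kAut _ _ 1%AS K {:L}%AS); rewrite ?sub1v ?subvf // -gal_kAut ?subvf.
  rewrite kAutE => /andP[_ tK].
  apply/polyOverP => i; rewrite coef_map /=; apply: (subvP tK); apply: memv_img.
  exact/polyOverP/minPolyOver.
rewrite !orbit_normE rmorphM rmorphXn rmorphN1 -[in RHS]tm.
by rewrite -(rmorph0 t) horner_map /= rmorph0.
Qed.

(* The stabiliser of the norm contains both the normal subgroup Gal(L/K) and the stabiliser
   of [a]. *)
Lemma orbit_norm_stab :
  (size r * #|'Gal({:L} / <<1; a>>)| <= #|'Gal({:L} / <<1; orbit_norm>>)|)%N.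
Proof.
set A := 'Gal({:L} / <<1; a>>); set N := 'Gal({:L} / K).
have sub : (N * A)%g \subset 'Gal({:L} / <<1; orbit_norm>>).
  apply/fintype.subsetP => _ /mulsgP[x y xN yA ->].
  have yG : y \in 'Gal({:L} / 1) by apply: fintype.subsetP yA; apply: galS; exact: sub1v.
  have xG : x \in 'Gal({:L} / 1) by apply: fintype.subsetP xN; apply: galS; exact: sub1v.
  apply: gal_stab; first by rewrite groupM.
  rewrite galM ?memvf // (fixed_gal (subvf _) xN) ?orbit_norm_mem //.
  by apply: orbit_norm_fix => //; apply: (fixed_gal (subvf _) yA); exact: memv_adjoin.
apply: leq_trans (subset_leq_card sub).
have NA : (N :&: A)%g \subset 'Gal({:L} / <<K; a>>).
  apply/fintype.subsetP => x /setIP[xN xA]; apply: gal_stab => //.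
  by apply: (fixed_gal (subvf _) xA); exact: memv_adjoin.
(* With h the order of the stabiliser of a in N, |N| |A| = |NA| |N :&: A| <= |NA| h, and |N| is h
   times the orbit size. *)
have := mul_cardG [group of N] [group of A]; rewrite /= (orbit_card rK ur mE) => e.
have h0 : (0 < #|'Gal({:L} / <<K; a>>)|)%N by rewrite cardG_gt0.
rewrite -(leq_pmul2r h0) mulnAC e leq_mul2l subset_leq_card ?orbT //.
Qed.

(** After raising to the power [h] both sides are compared with Galois products, where max(1, -) of
    a product is at most the product of the max(1, -). *)
Lemma local_mahler_orbit_norm :
  local_mahler w (iota orbit_norm) <= local_mahler w (iota a).
Proof.
set h := #|'Gal({:L} / <<1; orbit_norm>>)|.
have h0 : (0 < h)%N by rewrite cardG_gt0.
rewrite -(ler_pXn2r h0) ?nnegrE ?(le_trans ler01) ?prod_max1_ge1 //.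
rewrite -gal_prod_conjs.
apply: (@le_trans _ _ (local_mahler w (iota a) ^+ (size r * #|'Gal({:L} / <<1; a>>)|))); last first.
  by rewrite ler_weXn2l ?prod_max1_ge1 // orbit_norm_stab.
rewrite mulnC exprM -gal_prod_conjs.
(* Translating the group by x shows that a and its image x a give the same Galois product, so the
   power is spread over the orbit. *)
have -> : (\prod_(s in 'Gal({:L} / 1)) Num.max 1 (w (iota (s a)))) ^+ size r =
   \prod_(x <- r) \prod_(s in 'Gal({:L} / 1)) Num.max 1 (w (iota (s (x a)))).
  rewrite -[LHS]iter_mulr_1 -(count_predT r) -big_const_seq; apply: eq_big_seq => x xr.
  have xG : x \in 'Gal({:L} / 1).
    by apply: fintype.subsetP (fintype.subsetP rK _ xr); apply: galS; exact: sub1v.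
  rewrite (reindex_inj (mulgI x)) /=; apply: eq_big => [s|s _]; first by rewrite groupMl.
  by rewrite galM ?memvf.
rewrite exchange_big /=; apply: ler_prod => s _; rewrite le_max ler01 /=.
rewrite ge_max prod_max1_ge1 /=.
rewrite /orbit_norm !rmorph_prod absv_prod; apply: ler_prod => x _.
by rewrite absv_ge0 le_max lexx orbT.
Qed.

End NormalSubfield.
End OrbitProducts.

(** * Mahler measure under extraction of roots *)

Lemma conjs_exp m (b y : algC) : y \in conjs b -> y ^+ m \in conjs (b ^+ m).
Proof.
move=> yb; have [f [fE _] fP] := minCpolyP (b ^+ m).
have compE (z : algC) : (pQC (f \Po 'X^m)).[z] = (pQC f).[z ^+ m].
  by rewrite map_comp_poly horner_comp map_polyXn hornerXn.
rewrite mem_conjs fE /root -compE -/(root _ y) (conj_root_rat _ yb) /root compE.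
by rewrite -/(root _ _) fP.
Qed.

(** Conjugates of b are grouped by their m-th power z. A group has at most m members, all of the
    same absolute value, so its factor is at most max(1, w(z)). *)
Lemma local_mahler_exp (R : realType) (w : absval R algC) m (b : algC) : (0 < m)%N ->
  local_mahler w b <= local_mahler w (b ^+ m).
Proof.
move=> m0; rewrite /local_mahler [leLHS](eq_big_seq
  (fun y => \prod_(z <- conjs (b ^+ m) | y ^+ m == z) Num.max 1 (w y))); last first.
  move=> y yb; rewrite -big_filter.
  have -> : [seq z <- conjs (b ^+ m) | y ^+ m == z] = [:: y ^+ m].
    rewrite -[RHS](filter_pred1_uniq (uniq_conjs (b ^+ m)) (conjs_exp m yb)).
    by apply: eq_filter => t /=; rewrite eq_sym.
  by rewrite big_seq1.
rewrite (exchange_big_dep xpredT) //=; apply: ler_prod => z _.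
apply/andP; split; first by apply: prodr_ge0 => y _; exact: max1_ge0.
have [[y0 y0z]|no] := pselect (exists y0 : algC, y0 ^+ m = z); last first.
  rewrite big1_seq ?max1_ge1 // => y /andP[/eqP yz _].
  by exfalso; apply: no; exists y.
have wz : w z = w y0 ^+ m by rewrite -y0z absvX.
have -> : \prod_(y <- conjs b | y ^+ m == z) Num.max 1 (w y) =
   Num.max 1 (w y0) ^+ count (fun y => y ^+ m == z) (conjs b).
  rewrite -[RHS]iter_mulr_1 -big_const_seq; apply: eq_bigr => y /eqP yz; congr Num.max.
  by apply: (pexpIrn m0); rewrite ?nnegrE ?absv_ge0 // -wz -yz absvX.
have cnt : (count (fun y => y ^+ m == z) (conjs b) <= m)%N.
  rewrite -size_filter -ltnS -(size_XnsubC z m0); apply: max_poly_roots.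
  - by rewrite -size_poly_gt0 size_XnsubC.
  - by apply/allP => y; rewrite mem_filter => /andP[/eqP yz _]; rewrite /root !hornerE yz subrr.
  - by rewrite filter_uniq // uniq_conjs.
apply: le_trans (ler_weXn2l (max1_ge1 _) cnt) _; rewrite wz.
have [h|h] := leP (w y0) 1; first by rewrite expr1n max1_ge1.
by rewrite le_max lexx orbT.
Qed.

(** * Subfields of [algC] containing the Galois closure *)

Section DivringClosed.
Variables (F : {pred algC}) (cF : divring_closed F).

Lemma divring_rat q : ratr q \in F.
Proof.
have [F1 FB FV] := cF.
have F0 : 0 \in F by rewrite -(subrr 1) FB.
have FN x : x \in F -> - x \in F by move=> xF; rewrite -sub0r FB.
have FD x y : x \in F -> y \in F -> x + y \in F by move=> xF yF; rewrite -[y]opprK FB // FN.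
have Fn n : n%:R \in F by elim: n => // n IH; rewrite -natr1 FD.
have Fi (i : int) : i%:~R \in F.
  case: i => n; first exact: Fn.
  by rewrite NegzE mulrNz; apply: FN; exact: Fn.
by rewrite /ratr; apply: FV.
Qed.

(** [galois_closure] is an intersection of division-closed sets; this brings a field generated
    inside [L] into each of them. *)
Lemma divring_adjoin (L : fieldExtType rat) (iota : {rmorphism L -> algC}) (s : seq L) :
  (forall y, y \in s -> iota y \in F) -> forall x, x \in <<1 & s>>%VS -> iota x \in F.
Proof.
have [F1 FB FV] := cF.
have F0 : 0 \in F by rewrite -(subrr 1) FB.
have FN x : x \in F -> - x \in F by move=> xF; rewrite -sub0r FB.
have FD x y : x \in F -> y \in F -> x + y \in F by move=> xF yF; rewrite -[y]opprK FB // FN.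
have FM x y : x \in F -> y \in F -> x * y \in F.
  by move=> xF yF; rewrite -[y]invrK FV // -div1r FV.
elim/last_ind: s => [|s y IH] hs x.
  rewrite adjoin_nil subfield_closed => /vlineP[q ->].
  by rewrite alg_num_field fmorph_rat divring_rat.
rewrite adjoin_rcons => /Fadjoin_polyP[q /polyOverP qs ->].
have yF : iota y \in F by apply: hs; rewrite mem_rcons mem_head.
have {}IH : forall t, t \in <<1 & s>>%VS -> iota t \in F.
  by apply: IH => t ts; apply: hs; rewrite mem_rcons inE ts orbT.
rewrite horner_coef rmorph_sum; elim/big_ind: _ => // i _.
rewrite rmorphM rmorphXn; apply: (FM); first exact: IH.
by elim: (i : nat) => [|n IHn]; rewrite ?expr0 // exprS FM.
Qed.

End DivringClosed.

Theorem theorem2p1 (R : realType) (N : nat) (alpha : algC)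
  (alphas : 'I_N -> algC)
  (alpha_neq0 : alpha != 0)
  (alphas_neq0 : forall n, alphas n != 0)
  (alphaE : alpha = \prod_(n < N) alphas n) :
  exists (zeta : algC) (beta : 'I_N -> algC),
    [/\ is_root_of_unity zeta,
        alpha = zeta * \prod_(n < N) beta n,
        (forall n, radical_set (galois_closure alpha) (beta n)) &
        (forall n, mahler_measure R (beta n) <= mahler_measure R (alphas n))].
Proof.
have [L [iota [galL ex]]] := exists_splitting_field (alpha :: codom alphas).
have [z zE] := map_surj (fun y => ex alpha y (mem_head _ _)).
have /choice[a aE] n : exists a : L, iota a = alphas n.
  by apply: (ex (alphas n)); rewrite ?mem_conjs_self // inE codom_f orbT.
(* The copy of K_alpha in [L], generated by the conjugates of [alpha]. *)
pose K := <<1 & z>>%AS.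
have [al alz alE] : exists2 al, al \in z & iota al = alpha.
  by have := mem_conjs_self alpha; rewrite -zE => /mapP[al]; exists al.
have alK : al \in K by exact: seqv_sub_adjoin.
have nK : normalField 1 K.
  apply/splitting_normalField; first exact: sub1v.
  exists (minPoly 1 al); first exact: minPolyOver.
  exists z => //; have -> : minPoly 1 al = \prod_(t <- z) ('X - t%:P); last exact: eqpxx.
  apply: (map_poly_inj iota); rewrite map_minPoly_iota alE minCpoly_prod -zE big_map.
  by rewrite rmorph_prod /=; apply: eq_bigr => t _; rewrite map_polyXsubC.
have galK : galois K {:L} by apply: galoisS galL; rewrite sub1v subvf.
have /choice[r hr] n := galois_factors (subvf K) galK (a n) (memvf (a n)).
have r0 n : (0 < size (r n))%N.
  have [_ _ /(congr1 (fun q : {poly L} => size q))] := hr n.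
  rewrite size_prod_XsubC size_map => e.
  by have := root_size_gt1 (monic_neq0 (monic_minPoly K (a n))) (root_minPoly K (a n)); rewrite e.
pose c n := orbit_norm (a n) (r n).
pose beta n := (size (r n)).-root (iota (c n)).
have betaE n : beta n ^+ size (r n) = iota (c n) by rewrite rootCK.
have a0 n : a n != 0 by rewrite -(fmorph_eq0 iota) aE.
have c0 n : c n != 0.
  by rewrite /c /orbit_norm prodf_seq_neq0; apply/allP => x _; rewrite fmorph_eq0 a0.
have beta0 n : beta n != 0.
  apply: contraTneq (c0 n) => b0.
  by rewrite -(fmorph_eq0 iota) -betaE b0 expr0n eqn0Ngt r0 /= negbK.
have prod0 : \prod_(n < N) beta n != 0 by apply/prodf_neq0.
(* The root of unity is forced by (i); its order divides |Gal(L/K)|. *)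
exists (alpha / \prod_(n < N) beta n), beta; split.
- exists #|'Gal({:L} / K)%g|; first exact: cardG_gt0.
  suff e : alpha ^+ #|'Gal({:L} / K)%g| = (\prod_(n < N) beta n) ^+ #|'Gal({:L} / K)%g|.
    by rewrite expr_div_n e divff // expf_neq0.
  have alaE : al = \prod_(n < N) a n.
    by apply: (fmorph_inj iota); rewrite rmorph_prod alE alphaE; apply: eq_bigr => n _; rewrite aE.
  have -> : alpha ^+ #|'Gal({:L} / K)%g| = iota (\prod_(s in 'Gal({:L} / K)%g) s al).
    rewrite (eq_bigr (fun=> al)); last by move=> s sK; rewrite (fixed_gal (subvf K) sK).
    by rewrite prodr_const rmorphXn alE.
  rewrite (eq_bigr (fun s : gal_of {:L} => \prod_(n < N) s (a n))); last first.
    by move=> s _; rewrite alaE rmorph_prod.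
  rewrite exchange_big rmorph_prod -prodrXl; apply: eq_bigr => n _.
  have [rK ur mE] := hr n.
  (* The group order is the orbit size times the stabiliser order; the orbit size turns [beta n]
     into the norm, and the stabiliser order is the exponent in [orbit_prod]. *)
  by rewrite (orbit_prod id rK ur mE) (orbit_card rK ur mE) exprM betaE rmorphXn.
- by rewrite divfK.
- move=> n; split=> //; exists (size (r n)) => // F cF nF alF.
  (* A normal F containing [alpha] contains its conjugates, hence the image of [K], where the norm
     lies. *)
  rewrite betaE; apply: (divring_adjoin cF (s := z)).
    move=> y yz; apply: (nF alpha) => //; rewrite -mem_conjs -zE; exact: map_f.
  by have [rK ur mE] := hr n; exact: orbit_norm_mem mE.
- move=> n; have [W hW] := rational_extension_ex R.
  apply: (mahler_le hW) => p _; have [rK ur mE] := hr n.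
  apply: le_trans (local_mahler_exp (W p) (beta n) (r0 n)) _.
  by rewrite betaE -aE; exact: (local_mahler_orbit_norm iota galL (W p) nK rK ur mE).
Qed.
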